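(* Let $(\mathcal U^1_t)_{t\in[0,T]}$ and $(\mathcal U^2_t)_{t\in[0,T]}$ be $\mathbb F^1$- and $\mathbb F^2$-progressively measurable processes, respectively, and let $(\hat\xi,\hat\zeta)\in\mathcal A^\circ_0(\mathbb F^1)\times\mathcal A^\circ_0(\mathbb F^2)$. For $\xi\in\mathcal A^\circ_0(\mathbb F^1)$, $\zeta\in\mathcal A^\circ_0(\mathbb F^2)$, $\theta\in\mathcal T_0(\mathbb F^1)$, $\gamma\in\mathcal T_0(\mathbb F^2)$ define $$\hat M^\xi(\theta)=\mathsf E\Big[\int_{[0,\theta)}f_t(1-\hat\zeta_t)d\xi_t+\int_{[0,\theta)}g_t(1-\xi_t)d\hat\zeta_t+\sum_{t\in[0,\theta)}h_t\Delta\xi_t\Delta\hat\zeta_t\Big|\mathcal F^1_\theta\Big]+(1-\xi_{\theta-})\mathsf E[1-\hat\zeta_{\theta-}|\mathcal F^1_\theta]\,\mathcal U^1_\theta,$$ $$\hat N^\zeta(\gamma)=\mathsf E\Big[\int_{[0,\gamma)}f_t(1-\zeta_t)d\hat\xi_t+\int_{[0,\gamma)}g_t(1-\hat\xi_t)d\zeta_t+\sum_{t\in[0,\gamma)}h_t\Delta\hat\xi_t\Delta\zeta_t\Big|\mathcal F^2_\gamma\Big]+\mathsf E[1-\hat\xi_{\gamma-}|\mathcal F^2_\gamma](1-\zeta_{\gamma-})\,\mathcal U^2_\gamma.$$ Assume that (i) $\{\hat M^\xi(\theta),\theta\in\mathcal T_0(\mathbb F^1)\}$ is a $\mathcal T_0(\mathbb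 F^1)$-submartingale system for any $\xi\in\mathcal A^\circ_0(\mathbb F^1)$; (ii) $\{\hat N^\zeta(\gamma),\gamma\in\mathcal T_0(\mathbb F^2)\}$ is a $\mathcal T_0(\mathbb F^2)$-supermartingale system for any $\zeta\in\mathcal A^\circ_0(\mathbb F^2)$; (iii) $\mathsf E[\Delta\hat\zeta_T|\mathcal F^1_T]\,\mathcal U^1_T=\mathsf E[\Delta\hat\zeta_T h_T|\mathcal F^1_T]$ and $\mathsf E[\Delta\hat\xi_T|\mathcal F^2_T]\,\mathcal U^2_T=\mathsf E[\Delta\hat\xi_T h_T|\mathcal F^2_T]$; (iv) $\mathsf E[\mathcal U^1_0]=\mathsf E[\mathcal U^2_0]$. Then the game has a value, i.e., $\overline V=\underline V=\mathsf E[\mathcal U^1_0]=\mathsf E[\mathcal U^2_0]$, and the randomised stopping times $(\hat\tau,\hat\sigma)\in\mathcal T^R_0(\mathbb F^1)\times\mathcal T^R_0(\mathbb F^2)$ generated by $(\hat\xi,\hat\zeta)$ form a saddle point of the game.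
   Context: Let $T\in(0,\infty)$ and let $(\Omega,\mathcal F,\mathsf P)$ be a complete probability space with a right-continuous filtration $\mathbb F=(\mathcal F_t)_{t\in[0,T]}$ completed with $\mathsf P$-null sets, $\mathcal F_T\subsetneq\mathcal F$. Right-continuous filtrations $\mathbb F^i=(\mathcal F^i_t)_{t\in[0,T]}$, $i=1,2$, completed with null sets, satisfy $\mathcal F^1_t\vee\mathcal F^2_t\subseteq\mathcal F_t$. Equalities/inequalities between random variables are $\mathsf P$-a.s. The payoff processes $f,g,h$ are càdlàg, $\mathbb F$-adapted, with $\mathsf E[\sup_{0\le t\le T}(|f_t|+|g_t|+|h_t|)]<\infty$; no ordering of $f,g,h$ is required. For a filtration $\mathbb G\subseteq\mathbb F$: $\mathcal T_0(\mathbb G)$ is the set of $\mathbb G$-stopping times with values in $[0,T]$; $\mathcal A^\circ_0(\mathbb G)$ is the set of $\mathbb G$-adapted càdlàg non-decreasing $\rho$ with $\rho_{0-}:=0$ and $\rho_T=1$ (so $d\rho$ may charge $\{0\}$); $\Delta\rho_t=\rho_t-\rho_{t-}$. The $\mathbb G$-randomised stopping time generated by $\rho\in\mathcal A^\circ_0(\mathbb G)$ is $\eta=\inf\{t\in[0,T]:\rho_t>Z\}$ with $Z\sim U([0,1])$ independent of $\mathcal F_T$; the class of these is $\mathcal T^R_0(\mathbb G)$. The randomisation devices $Z$ of the two players are independent. Game: $\mathcal P(\tau,\sigma)=f_\tau\mathbf 1_{\{\tau<\sigma\}}+h_\tau\mathbf 1_{\{\tau=\sigma\}}+g_\sigma\mathbf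 1_{\{\sigma<\tau\}}$; $\overline V=\inf_{\tau\in\mathcal T^R_0(\mathbb F^1)}\sup_{\sigma\in\mathcal T^R_0(\mathbb F^2)}\mathsf E[\mathcal P(\tau,\sigma)]$, $\underline V=\sup_{\sigma\in\mathcal T^R_0(\mathbb F^2)}\inf_{\tau\in\mathcal T^R_0(\mathbb F^1)}\mathsf E[\mathcal P(\tau,\sigma)]$. A pair $(\hat\tau,\hat\sigma)$ is a saddle point if $\mathsf E[\mathcal P(\hat\tau,\sigma)]\le\mathsf E[\mathcal P(\hat\tau,\hat\sigma)]\le\mathsf E[\mathcal P(\tau,\hat\sigma)]$ for all $(\tau,\sigma)\in\mathcal T^R_0(\mathbb F^1)\times\mathcal T^R_0(\mathbb F^2)$. A family $\{X(\theta),\theta\in\mathcal T_0(\mathbb G)\}$ is a $\mathcal T_0(\mathbb G)$-system if $X(\theta)$ is $\mathcal G_\theta$-measurable and $X(\theta_1)=X(\theta_2)$ on $\{\theta_1=\theta_2\}$; it is a sub- (super-) martingale system if moreover $\mathsf E|X(\theta)|<\infty$ for all $\theta$ and $\mathsf E[X(\theta_2)|\mathcal G_{\theta_1}]\ge X(\theta_1)$ (resp. $\le$) whenever $\theta_1\le\theta_2$. *)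

(* Defs.v *)
From HB Require Import structures.
From mathcomp Require Import all_boot all_order all_algebra.
From mathcomp Require Import all_classical all_reals all_analysis.

Set Implicit Arguments.
Unset Strict Implicit.
Unset Printing Implicit Defensive.

Import Order.TTheory GRing.Theory Num.Theory.
Import numFieldNormedType.Exports.

Local Open Scope classical_set_scope.
Local Open Scope ring_scope.

(* Processes are functions R -> Omega -> R and filtrations are functions
   R -> set (set Omega); only times in [0, T] matter. *)

Section paths.
Context {R : realType}.
Implicit Types (x : R -> R) (t : R).

Definition cadlag_path (T : R) x :=
  (forall t, 0 <= t < T -> x s @[s --> t^'+] --> x t) /\
  (forall t, 0 < t <= T -> cvg (x s @[s --> t^'-])).

Definition left_lim x t : R := lim (x s @[s --> t^'-]).

Definition jump x t : R := x t - left_lim x t.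

(* \esum is meaningful for nonnegative terms only, hence the splitting into
   positive and negative parts. *)
Definition signed_sum (A : set R) (a : R -> R) : R :=
  fine (\esum_(t in A) (Num.max (a t) 0)%:E) -
  fine (\esum_(t in A) (Num.max (- a t) 0)%:E).

End paths.

Section stochastic_basis.
Context {d : measure_display} {Omega : measurableType d} {R : realType}.
Variables (P : probability Omega R) (T : R).
Implicit Types (G : set (set Omega)) (F : R -> set (set Omega)).
Implicit Types (X Y : Omega -> R) (theta : Omega -> R) (U : R -> Omega -> R).

Definition filtration F :=
  [/\ forall t, 0 <= t <= T ->
        sigma_algebra setT (F t) /\ F t `<=` @measurable d Omega,
      forall s t, 0 <= s -> s <= t -> t <= T -> F s `<=` F t,
      forall t, 0 <= t < T -> F t = \bigcap_(s in `]t, T]) F s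
    & forall t, 0 <= t <= T -> P.-negligible `<=` F t].

Definition measurable_wrt G X :=
  measurable_fun [set: g_sigma_algebraType G] (X : g_sigma_algebraType G -> R).

Definition adapted F U := forall t, 0 <= t <= T -> measurable_wrt (F t) (U t).

Definition progressive F U := forall t, 0 <= t <= T ->
  measurable_fun (`[0, t] `*` setT)
    (fun p : (measurableTypeR R * g_sigma_algebraType (F t))%type =>
       U p.1 p.2).

Definition stopping_time F theta :=
  (forall w, 0 <= theta w <= T) /\
  (forall t, 0 <= t <= T -> F t [set w | theta w <= t]).

Definition stopped F theta : set (set Omega) :=
  [set A | measurable A /\
           forall t, 0 <= t <= T -> F t (A `&` [set w | theta w <= t])].

Definition is_cond_exp G X Y :=
  [/\ measurable_wrt G Y,
      P.-integrable setT (EFin \o Y)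
    & forall A, G A ->
        (\int[P]_(w in A) (Y w)%:E = \int[P]_(w in A) (X w)%:E)%E].

(* A fixed (arbitrary) version; statements about it are almost sure. *)
Definition cond_exp G X : Omega -> R :=
  xget (fun=> 0) [set Y | is_cond_exp G X Y].

Definition time_system F (X : (Omega -> R) -> Omega -> R) :=
  (forall theta, stopping_time F theta ->
     measurable_wrt (stopped F theta) (X theta)) /\
  (forall theta1 theta2, stopping_time F theta1 -> stopping_time F theta2 ->
     {ae P, forall w, theta1 w = theta2 w -> X theta1 w = X theta2 w}).

Definition submartingale_system F (X : (Omega -> R) -> Omega -> R) :=
  [/\ time_system F X,
      forall theta, stopping_time F theta ->
        P.-integrable setT (EFin \o X theta)
    & forall theta1 theta2, stopping_time F theta1 -> stopping_time F theta2 ->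
        {ae P, forall w, theta1 w <= theta2 w} ->
        {ae P, forall w,
          X theta1 w <= cond_exp (stopped F theta1) (X theta2) w}].

Definition supermartingale_system F (X : (Omega -> R) -> Omega -> R) :=
  [/\ time_system F X,
      forall theta, stopping_time F theta ->
        P.-integrable setT (EFin \o X theta)
    & forall theta1 theta2, stopping_time F theta1 -> stopping_time F theta2 ->
        {ae P, forall w, theta1 w <= theta2 w} ->
        {ae P, forall w,
          cond_exp (stopped F theta1) (X theta2) w <= X theta1 w}].

(* Each path on [0, T] is extended to the real line by 0 on ]-oo, 0[ and by 1
   on [T, +oo[, which encodes rho_{0-} = 0 and rho_T = 1: the Lebesgue-Stieltjes
   measure of the extension is carried by [0, T] and may charge {0}, and the
   left limit of the extension at 0 is 0. A cumulative path is nondecreasing and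
   right-continuous, hence cadlag. *)
Definition generating F (rho : Omega -> cumulative R R) :=
  [/\ forall w t, t < 0 -> rho w t = 0,
      forall w t, T <= t -> rho w t = 1
    & adapted F (fun t w => rho w t)].

(* The set is nonempty whenever Z w < 1; otherwise inf set0 = 0, which for a
   uniform Z concerns a null event only. *)
Definition rand_time (rho : Omega -> cumulative R R) (Z : Omega -> R) :
    Omega -> R :=
  fun w => inf [set t | 0 <= t <= T /\ Z w < rho w t].

Definition uniform01 (Z : {RV P >-> R}) :=
  forall B, measurable B -> distribution P Z B = uniform_prob (@ltr01 R) B.

(* Mutual independence of G, Z1 and Z2. *)
Definition independent3 G (Z1 Z2 : {RV P >-> R}) :=
  forall A B1 B2, G A -> measurable B1 -> measurable B2 ->
    (P (A `&` Z1 @^-1` B1 `&` Z2 @^-1` B2) =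
     P A * P (Z1 @^-1` B1) * P (Z2 @^-1` B2))%E.

(* D1 and D2 collect the randomisation devices available to the players. Every
   device of one player must be independent of every device of the other; with
   unrestricted devices the players could use the same Z. *)
Definition randomisation_devices F (D1 D2 : set {RV P >-> R}) :=
  [/\ D1 !=set0 /\ D2 !=set0,
      forall Z, D1 Z -> uniform01 Z,
      forall Z, D2 Z -> uniform01 Z
    & forall Z1 Z2, D1 Z1 -> D2 Z2 -> independent3 (F T) Z1 Z2].

Definition randomised_times F (D : set {RV P >-> R}) : set (Omega -> R) :=
  [set eta | exists2 rho, generating F rho &
             exists2 Z, D Z & eta = rand_time rho Z].

End stochastic_basis.

Section game.
Context {d : measure_display} {Omega : measurableType d} {R : realType}.
Variables (P : probability Omega R) (T : R) (f g h : R -> Omega -> R).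
Implicit Types tau sigma theta : Omega -> R.
Implicit Types xi zeta : Omega -> cumulative R R.

Definition integrable_sup :=
  (\int[P]_w ereal_sup [set (`|f t w| + `|g t w| + `|h t w|)%R%:E
                       | t in `[0%R, T]%classic] < +oo)%E.

Definition payoff tau sigma : Omega -> R := fun w =>
  f (tau w) w * (tau w < sigma w)%R%:R +
  h (tau w) w * (tau w == sigma w)%R%:R +
  g (sigma w) w * (sigma w < tau w)%R%:R.

Definition expected_payoff tau sigma : \bar R := 'E_P[payoff tau sigma]%E.

Definition upper_value (S1 S2 : set (Omega -> R)) : \bar R :=
  ereal_inf [set ereal_sup [set expected_payoff tau sigma | sigma in S2]
            | tau in S1].

Definition lower_value (S1 S2 : set (Omega -> R)) : \bar R :=
  ereal_sup [set ereal_inf [set expected_payoff tau sigma | tau in S1]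
            | sigma in S2].

Definition saddle_point (S1 S2 : set (Omega -> R)) tau0 sigma0 :=
  [/\ S1 tau0, S2 sigma0 &
      forall tau sigma, S1 tau -> S2 sigma ->
        (expected_payoff tau0 sigma <= expected_payoff tau0 sigma0 /\
         expected_payoff tau0 sigma0 <= expected_payoff tau sigma0)%E].

Definition accrued xi zeta theta : Omega -> R := fun w =>
  \int[lebesgue_stieltjes_measure (xi w)]_(t in `[0, theta w[)
     (f t w * (1 - zeta w t)) +
  \int[lebesgue_stieltjes_measure (zeta w)]_(t in `[0, theta w[)
     (g t w * (1 - xi w t)) +
  signed_sum `[0, theta w[
     (fun t => h t w * jump (xi w) t * jump (zeta w) t).

Definition Mhat (F1 : R -> set (set Omega)) (U1 : R -> Omega -> R)
    (zetahat xi : Omega -> cumulative R R) theta : Omega -> R := fun w =>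
  cond_exp P (stopped T F1 theta) (accrued xi zetahat theta) w +
  (1 - left_lim (xi w) (theta w)) *
  cond_exp P (stopped T F1 theta)
    (fun w' => 1 - left_lim (zetahat w') (theta w')) w *
  U1 (theta w) w.

Definition Nhat (F2 : R -> set (set Omega)) (U2 : R -> Omega -> R)
    (xihat zeta : Omega -> cumulative R R) gamma : Omega -> R := fun w =>
  cond_exp P (stopped T F2 gamma) (accrued xihat zeta gamma) w +
  cond_exp P (stopped T F2 gamma)
    (fun w' => 1 - left_lim (xihat w') (gamma w')) w *
  (1 - left_lim (zeta w) (gamma w)) *
  U2 (gamma w) w.

End game.

(* Main.v *)
(* Evaluating the submartingale system at the deterministic times 0 and T gives
   E[U1_0] = E[M(0)] <= E[M(T)], and by the terminal condition and the tower
   property E[M(T)] is the expectation of the payoff accrued on [0, T) plus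
   h_T Delta xi_T Delta zetahat_T. That is exactly the expected payoff of the
   randomised times: given F_T, they are quantile transforms of two independent
   uniform variables, hence independent with laws d xi and d zetahat, and Fubini
   splits the payoff according to which time comes first. So against zetahat the
   first player pays at least E[U1_0]; symmetrically, against xihat the second
   player receives at most E[U2_0], and the two bounds agree. *)

Require Import Defs.
From mathcomp Require Import all_boot all_order all_algebra.
From mathcomp Require Import all_classical all_reals all_analysis.
From mathcomp Require Import measurable_realfun ring.

Set Implicit Arguments.
Unset Strict Implicit.
Unset Printing Implicit Defensive.

Import Order.TTheory GRing.Theory Num.Theory.
Import numFieldNormedType.Exports.

Local Open Scope classical_set_scope.
Local Open Scope ring_scope.

(** The pathwise computation rests on one identity: the Lebesgue-Stieltjes measure of a path is the
    law of its [quantile] under a uniform variable. Integrals against the paths thus become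
    integrals over the square of devices, and jumps become masses of atoms. The obstacle is
    measurability in the state: nothing in the definition of [accrued] shows it for the pathwise
    integrals or for [signed_sum]. It is recovered at the end, because [accrued] agrees almost
    surely with a function produced by Fubini, and completeness of [P] transfers measurability and
    integrability to it. In the tower property each player's own jump at T stays outside the
    conditional expectation: it is measurable for that player's filtration and lies in [0, 1]. The
    opponent's jump and h_T stay inside, as in the terminal condition. Since [cond_exp] is an
    arbitrarily chosen version, its existence is derived from Radon-Nikodym and the boundary values
    of the systems are identified only almost surely. *)

Definition mfun_pack {d1 d2} {T1 : measurableType d1} {T2 : measurableType d2}
    {f : T1 -> T2} (mf : measurable_fun setT f) : {mfun T1 >-> T2} :=
  MeasurableFun.Pack (MeasurableFun.Class (isMeasurableFun.Build _ _ _ _ _ mf)).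

Section ge0_le_integral_nonmeasurable.
Context {d} {T : measurableType d} {R : realType}.
Import HBNNSimple.

(* The integral of a nonnegative function is a supremum over simple minorants,
   so that no measurability is needed here. *)
Lemma ge0_le_integralT (mu : {measure set T -> \bar R}) (f1 f2 : T -> \bar R) :
  (forall x, 0 <= f1 x)%E -> (forall x, f1 x <= f2 x)%E ->
  (\int[mu]_x f1 x <= \int[mu]_x f2 x)%E.
Proof.
move=> f10 f12; rewrite !ge0_integralTE//; last by move=> x; exact: le_trans (f12 x).
apply: ge_ereal_sup => _ [h hf1 <-]; apply: ereal_sup_ubound.
by exists h => // x; exact: le_trans (f12 x).
Qed.

End ge0_le_integral_nonmeasurable.

(** * Conditional expectations *)

Section uniform01_layer_cake.
Context {R : realType}.

Lemma measurable_idR : measurable_fun setT (id : measurableTypeR R -> R).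
Proof. by move=> _ A mA; rewrite setTI. Qed.

(* [uniform_prob] is a measure on [measurableTypeR R], not on [R] itself. *)
Definition U01 : probability R R :=
  distribution (uniform_prob (@ltr01 R)) (mfun_pack measurable_idR).

Lemma U01E (A : set R) : measurable A ->
  U01 A = lebesgue_measure (A `&` `[0, 1]%classic).
Proof.
move=> mA; rewrite /U01/= /distribution/= /pushforward/= /uniform_prob.
rewrite integral_uniform_pdf.
under eq_integral => x.
  rewrite inE => -[_]; rewrite /= in_itv/= /uniform_pdf => ->.
  rewrite subr0 invr1; over.
by rewrite integral_cst ?mul1e//; exact: measurableI.
Qed.

Lemma natr_indic {T} (b : T -> bool) (u : T) :
  (b u)%:R = \1_[set u | b u] u :> R.
Proof.
rewrite indicE; case: (boolP (b u)) => h; first by rewrite mem_set.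
by rewrite memNset//; exact/negP.
Qed.

Lemma measurable_ltr (c : R) : measurable [set z : R | z < c].
Proof. by rewrite -set_itvNyo; exact: measurable_itv. Qed.
#[local] Hint Resolve measurable_ltr : core.

Lemma U01_ltr (c : R) : 0 <= c <= 1 -> U01 [set z | z < c] = c%:E.
Proof.
rewrite -set_itvNyo.
move=> /andP[c0 c1]; rewrite U01E//.
rewrite (_ : _ `&` _ = `[0, c[%classic); last first.
  apply/seteqP; split => z; rewrite /= !in_itv/=.
    by move=> [-> /andP[-> _]].
  by move=> /andP[-> zc]; rewrite zc; split => //; rewrite ltW// (lt_le_trans zc).
rewrite lebesgue_measure_itv/= lte_fin; case: ltP => [_|c0'].
  by rewrite oppr0 adde0.
by apply/esym/eqP; rewrite eqe eq_le c0 c0'.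
Qed.

(** Since k is the integral of the indicator of {u < k} over u in [0, 1], Fubini replaces the factor
    k by its superlevel sets. Sets are what the defining property of a conditional expectation
    speaks about. *)
Lemma integralM_layer_cake {d} {T : measurableType d} (P : probability T R)
    (k X : T -> R) :
  measurable_fun setT k -> (forall w, 0 <= k w <= 1) ->
  P.-integrable setT (EFin \o X) ->
  (\int[P]_w (k w * X w)%:E =
   \int[U01]_u \int[P]_(w in [set w | (u < k w)%R]) (X w)%:E)%E.
Proof.
move=> mk k01 iX; have mX : measurable_fun setT X.
  by apply/measurable_EFinP; exact: measurable_int iX.
pose H (p : T * R) : \bar R := ((p.2 < k p.1)%R%:R * X p.1)%:E.
have mb : measurable_fun setT (fun p : T * R => p.2 < k p.1).
  by apply: measurable_fun_ltr => //; exact: measurableT_comp.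
have mH : measurable_fun setT H.
  apply/measurable_EFinP; apply: measurable_funM; last exact: measurableT_comp.
  rewrite (_ : (fun _ => _) = (fun b : bool => b%:R) \o (fun p : T * R => p.2 < k p.1))//.
  exact: measurableT_comp.
(* The integrand is bounded by |X w| for every u, and U01 has mass 1. *)
have iH : (P \x U01)%E.-integrable setT H.
  apply/integrable12ltyP => //.
  have /integrableP[_] := iX; apply: le_lt_trans; apply: ge0_le_integralT.
    by move=> w; exact: integral_ge0.
  move=> w; rewrite -[leRHS]mule1 -(probability_setT U01) -integral_cst//.
  apply: ge0_le_integralT => // u; rewrite /H lee_fin normrM ler_piMl//.
  by case: ltP; rewrite ?normr1// normr0.
transitivity (\int[P]_w \int[U01]_u H (w, u))%E.
  apply: eq_integral => w _; rewrite /H/=.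
  under eq_integral do rewrite EFinM muleC.
  rewrite /H/=; under eq_integral do rewrite (natr_indic (fun z => z < k w)).
  rewrite integralZl//; last first.
    apply: integrable_indic => //; exact: fin_num_measure.
  rewrite integral_indic// setIT EFinM muleC; congr (_ * _)%E.
  by apply/esym; exact: U01_ltr.
rewrite Fubini//; apply: eq_integral => u _.
rewrite [RHS]integral_mkcond; apply: eq_integral => w _.
rewrite /H/= patchE; case: ifPn.
  by rewrite inE/= => ->; rewrite mul1r.
by rewrite notin_setE/= => /negP/negbTE ->; rewrite mul0r.
Qed.

End uniform01_layer_cake.

Section conditional_expectation.
Context {d} {Omega : measurableType d} {R : realType} (P : probability Omega R).
Implicit Types (X Y : Omega -> R).

Definition is_sub_sigma_algebra (G : set (set Omega)) :=
  sigma_algebra setT G /\ G `<=` @measurable d Omega.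

Variable G : set (set Omega).
Hypothesis sG : is_sub_sigma_algebra G.

Lemma measurable_gE (A : set Omega) :
  @measurable _ (g_sigma_algebraType G) A = G A.
Proof. by rewrite /measurable/= sigma_algebra_id//; case: sG. Qed.

Lemma measurable_id_wrt :
  measurable_fun setT (id : Omega -> g_sigma_algebraType G).
Proof.
move=> _ A; rewrite measurable_gE setTI => GA.
by case: sG => _; exact.
Qed.

Lemma measurable_wrtW X : measurable_wrt G X -> measurable_fun setT X.
Proof. by move=> mX; exact: measurableT_comp mX measurable_id_wrt. Qed.

(** Existence by Radon-Nikodym. Pushing P and the charge A |-> E[X 1_A] forward along the identity
    into (Omega, G) restricts both to G, and the density of the second with respect to the first is
    the required function. The density is finite everywhere, so [fine] loses nothing. *)
Lemma cond_expP X : P.-integrable setT (EFin \o X) ->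
  is_cond_exp P G X (cond_exp P G X).
Proof.
move=> iX; apply: xgetPex.
pose PG := distribution P (mfun_pack measurable_id_wrt).
pose nu := [the charge _ _ of
  pushforward (induced_charge iX) (id : Omega -> g_sigma_algebraType G)].
pose nu' := nu measurable_id_wrt.
have nuPG : nu' `<< PG.
  apply: (@dominates_pushforward _ _ _ _ _ P (induced_charge iX)).
    exact: measurable_id_wrt.
  apply/null_content_dominatesP => A mA PA0; apply: null_set_integral => //.
  by apply: measurable_funTS; exact: measurable_int iX.
have fnY w := Radon_Nikodym_fin_num w nuPG.
have iY := Radon_Nikodym_integrable nuPG.
exists (fine \o Radon_Nikodym nu' PG).
have EY : EFin \o (fine \o (Radon_Nikodym nu' PG)) = (Radon_Nikodym nu' PG).
  by apply/funext => w /=; rewrite fineK.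
have mY : measurable_fun setT (Radon_Nikodym nu' PG) := measurable_int _ iY.
have iYP : P.-integrable setT (Radon_Nikodym nu' PG).
  apply/integrableP; split.
    exact: (measurableT_comp mY measurable_id_wrt).
  have /integrableP[_] := iY; rewrite ge0_integral_distribution//.
  exact: measurableT_comp.
split.
- exact: measurableT_comp mY.
- by rewrite EY.
- move=> A GA; have mA : @measurable _ (g_sigma_algebraType G) A.
    by rewrite measurable_gE.
  under eq_integral do rewrite /= fineK//.
  transitivity (nu' A) => //.
  rewrite (Radon_Nikodym_integral nuPG)// /PG.
  rewrite /distribution integral_pushforward//.
  apply: (integrableS measurableT) => //.
  by case: sG => _; exact.
Qed.

(** Equal integrals over all sets of G give equality almost everywhere for P restricted to G; the
    exceptional set lies in G, so it is a P-null event as well. *)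
Lemma cond_exp_unique X Y1 Y2 :
  is_cond_exp P G X Y1 -> is_cond_exp P G X Y2 -> {ae P, forall w, Y1 w = Y2 w}.
Proof.
move=> [mY1 iY1 Y1E] [mY2 iY2 Y2E].
pose PG := distribution P (mfun_pack measurable_id_wrt).
have mEFin Y : measurable_wrt G Y -> @measurable_fun _ _ (g_sigma_algebraType G)
    (\bar R) setT (EFin \o Y).
  by move=> mY; exact/measurable_EFinP.
have PGE A (Y : Omega -> R) : G A -> measurable_wrt G Y ->
    P.-integrable setT (EFin \o Y) ->
    (\int[PG]_(w in A) (Y w)%:E = \int[P]_(w in A) (Y w)%:E)%E.
  move=> GA mY iY; rewrite /PG /distribution integral_pushforward//.
  - exact: mEFin.
  - apply: (integrableS measurableT) => //.
    by case: sG => _; exact.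
  - by rewrite measurable_gE.
have [N [mN PN0 subN]] : ae_eq PG setT (EFin \o Y1) (EFin \o Y2).
  apply: integral_ae_eq => //.
  - apply: integrable_pushforward => //; exact: mEFin.
  - exact: mEFin.
  - move=> A _; rewrite measurable_gE => GA.
    by rewrite !PGE// Y1E// Y2E.
exists N; split => //.
  by apply: (proj2 sG); rewrite -measurable_gE.
apply: subset_trans subN => w /=; apply: contra_not => /(_ I).
by case.
Qed.

Lemma integral_is_cond_exp X Y : is_cond_exp P G X Y ->
  (\int[P]_w (Y w)%:E = \int[P]_w (X w)%:E)%E.
Proof.
by move=> [_ _]; apply; rewrite -measurable_gE; exact: measurableT.
Qed.

Lemma integrableM01 (k X : Omega -> R) :
  measurable_fun setT k -> (forall w, 0 <= k w <= 1) ->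
  P.-integrable setT (EFin \o X) ->
  P.-integrable setT (fun w => (k w * X w)%:E).
Proof.
move=> mk k01 iX; apply: (le_integrable _ _ _ iX) => //.
  apply/measurable_EFinP/measurable_funM => //.
  by apply/measurable_EFinP; exact: measurable_int iX.
move=> w _; rewrite /= lee_fin normrM ler_piMl//.
by have /andP[k0 k1] := k01 w; rewrite ger0_norm.
Qed.

(** After the layer-cake formula both sides integrate over the sets {u < k}, which belong to G
    because k is G-measurable. *)
Lemma integralM_is_cond_exp k X Y :
  measurable_wrt G k -> (forall w, 0 <= k w <= 1) ->
  P.-integrable setT (EFin \o X) -> is_cond_exp P G X Y ->
  (\int[P]_w (k w * Y w)%:E = \int[P]_w (k w * X w)%:E)%E.
Proof.
move=> mk k01 iX [mY iY YE]; have mk' := measurable_wrtW mk.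
rewrite !integralM_layer_cake//; apply: eq_integral => u _; apply: YE.
rewrite -measurable_gE -[X in measurable X]setTI.
rewrite (_ : [set w | _] = k @^-1` `]u, +oo[%classic); first exact: mk.
by apply/seteqP; split => w /=; rewrite in_itv/= andbT.
Qed.

(** The tower step in the shape taken by the systems at time T: [A] will be the accrued payoff, [k]
    the player's own jump and [X] the opponent's jump times h_T. *)
Lemma integral_cond_expD (A X k : Omega -> R) :
  P.-integrable setT (EFin \o A) -> P.-integrable setT (EFin \o X) ->
  measurable_wrt G k -> (forall w, 0 <= k w <= 1) ->
  (\int[P]_w (cond_exp P G A w + k w * cond_exp P G X w)%:E =
   \int[P]_w (A w + k w * X w)%:E)%E.
Proof.
move=> iA iX mk k01; have cA := cond_expP iA; have cX := cond_expP iX.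
have mk' := measurable_wrtW mk.
have [_ iA' _] := cA; have [_ iX' _] := cX.
under eq_integral do rewrite EFinD.
rewrite integralD//; last exact: integrableM01.
under [RHS]eq_integral do rewrite EFinD.
rewrite [RHS]integralD//; last exact: integrableM01.
by rewrite (integral_is_cond_exp cA) (integralM_is_cond_exp mk k01 iX cX).
Qed.

End conditional_expectation.

(** * Randomised times as quantile transforms *)

Section cumulative_distribution.
Context {R : realType}.
Variables (T : R) (T_ge0 : 0 <= T).
Implicit Types (x : cumulative R R) (t z c : R).

Definition unit_path x := (forall t, t < 0 -> x t = 0) /\ (forall t, T <= t -> x t = 1).

(* [rand_time T rho Z w] is convertible to [quantile (rho w) (Z w)]. *)
Definition quantile x z : R := inf [set t | 0 <= t <= T /\ z < x t].

Lemma cumulative_le x s t : s <= t -> x s <= x t.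
Proof. by move=> st; exact: cumulative_is_nondecreasing. Qed.

Lemma unit_path01 x t : unit_path x -> 0 <= x t <= 1.
Proof.
move=> [x0 x1]; apply/andP; split.
- have [t0|t0] := ltP t 0; first by rewrite x0.
  by rewrite -(x0 (-1)) ?ltrN10//; apply: cumulative_le; rewrite (le_trans _ t0)// lerN10.
- have [t1|t1] := leP T t; first by rewrite x1.
  by rewrite -(x1 T)//; apply: cumulative_le; exact: ltW.
Qed.

Lemma left_lim_cvg x t : x s @[s --> t^'-] --> left_lim x t.
Proof.
apply: nondecreasing_at_left_is_cvgr.
- by apply: nearW => a s u _ _; exact: cumulative_le.
- apply: nearW => a; exists (x t) => _ [s + <-].
  by rewrite /= in_itv/= => /andP[_ /ltW]; exact: cumulative_le.
Qed.

Lemma left_lim_le x t : left_lim x t <= x t.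
Proof.
apply: (cvgr_to_le (@left_lim_cvg x t)).
near=> s; apply: cumulative_le; apply: ltW; near: s; exact: nbhs_left_lt.
Unshelve. all: by end_near. Qed.

Lemma left_lim_ge0 x t : unit_path x -> 0 <= left_lim x t.
Proof.
move=> px; apply: (cvgr_to_ge (@left_lim_cvg x t)).
by apply: nearW => s; have /andP[] := unit_path01 s px.
Qed.

Lemma left_lim0 x : unit_path x -> left_lim x 0 = 0.
Proof.
move=> [x0 _]; apply/cvg_lim => //; apply: cvg_near_cst.
near=> s; apply: x0; near: s; exact: nbhs_left_lt.
Unshelve. all: by end_near. Qed.

Lemma jump01 x t : unit_path x -> 0 <= jump x t <= 1.
Proof.
move=> px; rewrite /jump subr_ge0 left_lim_le/=.
have /andP[_ x1] := unit_path01 t px.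
by rewrite lerBlDr (le_trans x1)// lerDl left_lim_ge0.
Qed.

Lemma jumpT x : unit_path x -> jump x T = 1 - left_lim x T.
Proof. by move=> [_ x1]; rewrite /jump x1. Qed.

Lemma quantile_itv x z : 0 <= quantile x z <= T.
Proof.
rewrite /quantile; set A := [set t | _].
have [->|/set0P A0] := eqVneq A set0; first by rewrite inf0 lexx.
have lbA : lbound A 0 by move=> t [/andP[]].
rewrite lb_le_inf//=; have [t At] := A0.
apply: (@le_trans _ _ t); first by apply: ge_inf => //; exists 0.
by case: At => /andP[].
Qed.

Lemma quantile_le x t z : 0 <= t <= T -> z < x t -> quantile x z <= t.
Proof.
move=> t0T zt; apply: ge_inf; last by split.
by exists 0 => s [/andP[]].
Qed.

(** Rational witnesses make the event a countable union, hence jointly measurable in the path and z.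
    The clause [1 <= z] records the default value 0 of [inf] on the empty set. *)
Lemma quantile_ltP x z c : unit_path x ->
  quantile x z < c <->
  0 < c /\ (1 <= z \/ exists2 r : rat, ratr r < c & z < x (ratr r)).
Proof.
move=> px; have [x0 x1] := px; split.
  move=> qc; have /andP[q0 _] := quantile_itv x z.
  split; first exact: le_lt_trans qc.
  have [z1|z1] := leP 1 z; [by left|right].
  have [|t [/andP[t0 tT] zt] tc] := inf_lt _ qc.
    by exists T => /=; rewrite T_ge0 lexx x1.
  have [r] := rat_in_itvoo tc; rewrite in_itv/= => /andP[tr rc].
  by exists r => //; rewrite (lt_le_trans zt)//; apply: cumulative_le; exact: ltW.
move=> [c0 [z1|[r rc zr]]].
  rewrite /quantile (_ : [set t | _] = set0) ?inf0//.
  rewrite -subset0 => t /= [_]; have /andP[_ xt1] := unit_path01 t px.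
  by rewrite ltNge (le_trans xt1).
(* A rational outside [0, T] is moved to the nearer endpoint: 0 works by monotonicity, and T because
   the path is already 1 there. *)
have [r0|r0] := ltP (ratr r) (0 : R).
  apply: le_lt_trans c0; apply: quantile_le; first by rewrite lexx.
  by rewrite (lt_le_trans zr)//; apply: cumulative_le; exact: ltW.
have [rT|rT] := leP (ratr r) T.
  by apply: le_lt_trans rc; apply: quantile_le => //; rewrite r0.
apply: le_lt_trans (lt_trans rT rc); apply: quantile_le.
  by rewrite T_ge0 lexx.
by rewrite x1// -(x1 (ratr r))// ltW.
Qed.

(** Every c > t has z < x c, and right-continuity lets c decrease to t. The strict inequality
    required by [quantile_le] becomes a weak one; the gap z = x t is a null event. *)
Lemma quantile_le_imp x t z : unit_path x -> quantile x z <= t ->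
  z <= x t \/ 1 <= z.
Proof.
move=> px qt; have [z1|z1] := leP 1 z; [by right|left].
apply: (cvgr_to_ge (cumulative_is_right_continuous x t)).
near=> c.
have tc : t < c by near: c; exact: nbhs_right_gt.
have /(quantile_ltP _ _ px)[_ [|[r rc zr]]] := le_lt_trans qt tc.
  by rewrite leNgt z1.
by apply: ltW; rewrite (lt_le_trans zr)//; apply: cumulative_le; exact: ltW.
Unshelve. all: by end_near. Qed.

Lemma measurable_quantile {d} {S : measurableType d} (rho : S -> cumulative R R) :
  (forall w, unit_path (rho w)) ->
  (forall t, measurable_fun setT (fun w => rho w t)) ->
  measurable_fun setT (fun p : S * R => quantile (rho p.1) p.2).
Proof.
move=> prho mrho; apply: (measurability _ (RGenInftyO.measurableE R)).
move=> _ [_ [c ->] <-]; rewrite setTI.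
have [c0|c0] := ltP 0 c; last first.
  rewrite (_ : _ @^-1` _ = set0)//.
  rewrite -subset0 => p /=; rewrite in_itv/= => qc.
  have /andP[q0 _] := quantile_itv (rho p.1) p.2.
  by move: (le_lt_trans q0 qc); rewrite ltNge c0.
rewrite (_ : _ @^-1` _ = [set p | 1 <= p.2] `|`
    \bigcup_(r : rat) [set p | (ratr r < c) && (p.2 < rho p.1 (ratr r))]).
  have mpre (b : S * R -> bool) : measurable_fun setT b -> measurable [set p | b p].
    by move=> mb; rewrite -[X in measurable X]setTI; exact: (mb measurableT [set true]).
  apply: measurableU; first by apply: mpre; exact: measurable_fun_ler.
  apply: bigcupT_measurable_rat => r; apply: mpre; apply: measurable_and => //.
  apply: measurable_fun_ltr => //.
  exact: measurableT_comp (mrho _) _.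
apply/seteqP; split => p /=; rewrite in_itv/=.
  move=> /(quantile_ltP _ _ (prho _))[_ [|[r rc pr]]]; first by left.
  by right; exists r => //=; rewrite rc.
move=> h; apply/(quantile_ltP _ _ (prho _)); split => //.
by case: h => [|[r _ /andP[rc pr]]]; [left|right; exists r].
Qed.

Lemma measurable_quantileR x : unit_path x -> measurable_fun setT (quantile x).
Proof.
move=> px; have := @measurable_quantile _ unit (fun=> x) (fun=> px).
move=> /(_ (fun=> measurable_cst _)) mq.
exact: (measurableT_comp mq (pair1_measurable tt)).
Qed.

End cumulative_distribution.

Section quantile_distribution.
Context {R : realType}.
Variables (T : R) (T_ge0 : 0 <= T) (x : cumulative R R) (px : unit_path T x).
Local Notation q := (quantile T x).
Local Notation U := (@U01 R).

(** The part [1 <= z], caused by the default value in [quantile], meets [0, 1] only in the null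
    point 1. *)
Lemma U01_le (c : R) (A : set R) : measurable A -> 0 <= c <= 1 ->
  A `<=` [set z | z <= c \/ 1 <= z] -> (U A <= c%:E)%E.
Proof.
move=> mA /andP[c0 c1] Ac; rewrite U01E//.
have -> : c%:E =
    (lebesgue_measure `[0%R, c]%classic + lebesgue_measure [set 1%R])%E :> \bar R.
  rewrite lebesgue_measure_set1 adde0 lebesgue_measure_itv/= lte_fin.
  case: ltP => [_|c0']; first by rewrite oppr0 adde0.
  by apply/esym/eqP; rewrite eqe eq_le c0 c0'.
apply: le_trans (measureU2 _ _ _) => //.
apply: le_measure; rewrite ?inE.
- exact: measurableI.
- exact: measurableU.
move=> z [/Ac /= zc]; rewrite /= in_itv/= => /andP[z0 z1].
case: zc => [zc|z1']; first by left; rewrite /= in_itv/= z0 zc.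
by right; apply/eqP; rewrite /= eq_le z1 z1'.
Qed.

Let mq : measurable_fun setT q.
Proof. exact: measurable_quantileR. Qed.

Lemma measurable_quantile_le (t : R) : measurable [set z | q z <= t].
Proof.
have := mq measurableT (measurable_itv `]-oo, t]).
by rewrite setTI (_ : _ @^-1` _ = [set z | q z <= t]).
Qed.

Lemma measurable_quantile_lt (t : R) : measurable [set z | q z < t].
Proof.
have := mq measurableT (measurable_itv `]-oo, t[).
by rewrite setTI (_ : _ @^-1` _ = [set z | q z < t]).
Qed.

(** For t in [0, T[ the event lies between {z < x t} and {z <= x t or 1 <= z}, both of uniform mass
    x t; the other values of t are trivial. *)
Lemma quantile_cdf (t : R) : U [set z | q z <= t] = (x t)%:E.
Proof.
have [x0 x1] := px.
have [t0|t0] := ltP t 0.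
  rewrite (_ : [set z | _] = set0) ?measure0 ?x0//.
  rewrite -subset0 => z /=; have /andP[q0 _] := quantile_itv T_ge0 x z.
  by rewrite leNgt (lt_le_trans t0).
have [tT|tT] := leP T t.
  rewrite (_ : [set z | _] = setT) ?probability_setT ?x1//.
  rewrite -subTset => z _ /=; have /andP[_ qT] := quantile_itv T_ge0 x z.
  exact: le_trans tT.
have xt01 := unit_path01 t px.
apply/eqP; rewrite eq_le; apply/andP; split.
  apply: U01_le => //; first exact: measurable_quantile_le.
  by move=> z /=; exact: quantile_le_imp.
rewrite -U01_ltr//; apply: le_measure; rewrite ?inE.
- exact: measurable_ltr.
- exact: measurable_quantile_le.
by move=> z /= zt; apply: quantile_le => //; rewrite t0 ltW.
Qed.

Lemma quantile_lt_prob (t : R) : U [set z | q z < t] = (left_lim x t)%:E.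
Proof.
pose u n : R := t - n.+1%:R^-1.
have ut n : u n < t by rewrite ltrBlDr ltrDl invr_gt0.
have ucvg : u n @[n --> \oo] --> t.
  rewrite -[X in _ --> X]subr0; apply: cvgB; first exact: cvg_cst.
  exact: cvg_harmonic.
have /cvg_at_leftP/(_ u (conj ut ucvg)) xu := @left_lim_cvg _ x t.
have E : [set z | q z < t] = \bigcup_n [set z | q z <= u n].
  apply/seteqP; split => z /=; last by move=> [n _ /= /le_lt_trans]; apply.
  move=> qt; have /ltr_add_invr[n qn] := qt.
  by exists n => //=; rewrite lerBrDr ltW.
have h : (U \o (fun n => [set z | q z <= u n])) n @[n --> \oo] --> U [set z | q z < t].
  rewrite E; apply: nondecreasing_cvg_mu.
  - by move=> n; exact: measurable_quantile_le.
  - by rewrite -E; exact: measurable_quantile_lt.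
  - move=> m n mn; apply/subsetPset => z /= /le_trans; apply.
    by rewrite lerB// lef_pV2 ?posrE// ler_nat.
apply/(cvg_unique _ h) => //.
rewrite (_ : _ \o _ = EFin \o (fun n => x (u n))).
  by apply/cvg_EFin; [exact: nearW|exact: xu].
by apply/funext => n /=; rewrite quantile_cdf.
Qed.

Lemma quantile_atom (t : R) : U [set z | q z = t] = (jump x t)%:E.
Proof.
rewrite (_ : [set z | _] = [set z | q z <= t] `\` [set z | q z < t]).
  rewrite measureD//.
  - rewrite setIidr; last by move=> z /= /ltW.
    rewrite /jump EFinB; congr (_ - _)%E; first exact: quantile_cdf.
    exact: quantile_lt_prob.
  - exact: measurable_quantile_le.
  - exact: measurable_quantile_lt.
  - by rewrite -ge0_fin_numE// fin_num_measure//; exact: measurable_quantile_le.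
apply/seteqP; split => z /=; first by move=> ->; rewrite lexx ltxx.
by move=> [qt /negP]; rewrite -leNgt => tq; apply/eqP; rewrite eq_le qt.
Qed.

(** By [quantile_cdf] both measures give x b - x a to ]a, b], and the Lebesgue-Stieltjes measure is
    determined by these intervals. *)
Lemma lebesgue_stieltjes_quantile (A : set R) : measurable A ->
  lebesgue_stieltjes_measure x A = U (q @^-1` A).
Proof.
move=> mA.
have mq' : measurable_fun setT (q : R -> measurableTypeR R) by [].
pose mu := distribution U (mfun_pack mq').
apply: (@lebesgue_stieltjes_measure_unique _ x mu) => //.
move=> _ [[a b] _ <-] /=.
rewrite /lebesgue_stieltjes_measure /measure_extension measurable_mu_extE/=; last first.
  exact: is_ocitv.
rewrite /mu/= /distribution/= /pushforward/=.
have [ab|ba] := leP a b; last first.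
  by rewrite set_itv_ge ?wlength0 ?preimage_set0 ?measure0// bnd_simp -leNgt ltW.
rewrite wlength_itv_bnd// (_ : _ @^-1` _ = [set z | q z <= b] `\` [set z | q z <= a]).
  rewrite measureD//.
  - rewrite setIidr; last by move=> z /= /le_trans; apply.
    by rewrite EFinB; congr (_ - _)%E; apply/esym; exact: quantile_cdf.
  - exact: measurable_quantile_le.
  - exact: measurable_quantile_le.
  - by rewrite -ge0_fin_numE// fin_num_measure//; exact: measurable_quantile_le.
apply/seteqP; split => z /=; rewrite in_itv/=.
  by move=> /andP[az zb]; split => //; apply/negP; rewrite -ltNge.
by move=> [-> /negP]; rewrite -ltNge => ->.
Qed.

(** Change of variables. Integrability keeps the left side finite, so that the [fine] hidden in the
    real-valued integral on the right is harmless. *)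
Lemma integral_quantile (D : set R) (phi : R -> R) :
  measurable D -> measurable_fun setT phi ->
  U.-integrable setT (fun z => ((phi \_ D) (q z))%:E) ->
  (\int[U]_z ((phi \_ D) (q z))%:E)%E =
  (\int[lebesgue_stieltjes_measure x]_(t in D) phi t)%:E.
Proof.
move=> mD mphi iphi; have mphiD : measurable_fun setT (phi \_ D).
  by apply/(measurable_restrictT _ _).1 => //; exact: measurable_funTS.
rewrite -[LHS]fineK; last exact: integrable_fin_num.
congr (_%:E); rewrite /Rintegral; congr fine.
have mq' : measurable_fun setT (q : R -> measurableTypeR R) by [].
pose mu := distribution U (mfun_pack mq').
transitivity (\int[mu]_(t in D) (phi t)%:E)%E; last first.
  apply: eq_measure_integral => A mA _; exact/esym/lebesgue_stieltjes_quantile.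
rewrite [RHS]integral_mkcond restrict_EFin.
have mE : measurable_fun setT (EFin \o (phi \_ D)) by exact/measurable_EFinP.
rewrite /mu [RHS]integral_pushforward//.
Qed.

End quantile_distribution.

(** * Payoff of two randomised times along a fixed path *)

Lemma measurable_left_lim {R : realType} (x : cumulative R R) :
  measurable_fun setT (left_lim x).
Proof.
apply: (@measurable_fun_cvg _ _ _ _ (fun n (t : R) => x (t - n.+1%:R^-1))).
  move=> n; apply: nondecreasing_measurable => // s t st.
  by apply: cumulative_le; rewrite lerB.
move=> t _; have /cvg_at_leftP := @left_lim_cvg _ x t; apply; split.
  by move=> n; rewrite ltrBlDr ltrDl invr_gt0.
rewrite -[X in _ --> X]subr0; apply: cvgB; first exact: cvg_cst.
exact: cvg_harmonic.
Qed.

Lemma measurable_cumulative {R : realType} (x : cumulative R R) :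
  measurable_fun setT x.
Proof. by apply: nondecreasing_measurable => // s t; exact: cumulative_le. Qed.

Lemma measurable_jump {R : realType} (x : cumulative R R) :
  measurable_fun setT (jump x).
Proof.
exact: measurable_funB (measurable_cumulative x) (measurable_left_lim x).
Qed.

Section jump_sum.
Context {R : realType}.
Variables (T : R) (T_ge0 : 0 <= T) (x y : cumulative R R).
Hypotheses (px : unit_path T x) (py : unit_path T y).
Local Notation q := (quantile T x).
Local Notation U := (@U01 R).

Let mq : measurable_fun setT q.
Proof. exact: measurable_quantileR. Qed.

(** The jumps of y are the atoms of the law of its quantile, and a probability has countably many
    atoms. *)
Lemma countable_jump : countable [set t | 0 < jump y t].
Proof.
have := pmf_gt0_countable (P := U) (mfun_pack (measurable_quantileR T_ge0 py)).
congr countable; apply/funext => t /=; congr (0 < _).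
rewrite /pmf; transitivity (fine (jump y t)%:E) => //.
by rewrite -(quantile_atom T_ge0 py).
Qed.

Lemma measurable_preimage_quantile (A : set R) :
  measurable A -> measurable (q @^-1` A).
Proof. by move=> mA; rewrite -[X in measurable X]setTI; exact: mq. Qed.

(* The atoms of the law of the quantile carry its integral against a function
   that lives on the countably many jumps of [y]. *)
Lemma integral_quantile_esum (D : set R) (a : R -> R) :
  measurable_fun setT a -> (forall t, 0 <= a t) ->
  (forall t, ~ D t -> a t = 0) -> (forall t, jump y t = 0 -> a t = 0) ->
  (\int[U]_z (a (q z))%:E = \esum_(t in D) (a t * jump x t)%:E)%E.
Proof.
move=> ma a0 aD ay; have mEa : measurable_fun setT (fun z => (a (q z))%:E).
  by apply/measurable_EFinP; exact: measurableT_comp.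
pose C := D `&` [set t | 0 < jump y t].
have cC : countable C.
  by apply: sub_countable countable_jump; apply: subset_card_le; exact: subIsetr.
have [e einj] : exists e : R -> nat, {in C &, injective e} by exact/countable_injP.
have aC t : ~ C t -> a t = 0.
  move=> /not_andP[/aD//|/negP]; rewrite -leNgt => jy0; apply: ay.
  by apply/eqP; rewrite eq_le jy0; have /andP[] := jump01 t py.
(* The fibres of the injection [e] are empty or singletons, so C becomes a disjoint union indexed by
   nat and the integral is additive over it. *)
pose J k := C `&` e @^-1` [set k].
have JE k : J k = set0 \/ exists t, J k = [set t].
  have [->|/set0P[t Jt]] := eqVneq (J k) set0; [by left|right; exists t].
  apply/seteqP; split => [s Js|_ ->//].
  by apply: einj; rewrite ?inE; [exact: Js.1|exact: Jt.1|rewrite Js.2 Jt.2].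
have mJ k : measurable (J k) by case: (JE k) => [->//|[t ->]].
have tJ : trivIset setT J.
  by apply/trivIsetP => i j _ _ ij; rewrite -subset0 => t [[_ ti] [_ tj]];
    move/eqP: ij; apply; rewrite -ti -tj.
have UJ : \bigcup_k J k = C.
  by apply/seteqP; split => t; [move=> [k _ []]|move=> Ct; exists (e t)].
have aj0 t : (0 <= (a t * jump x t)%:E)%E.
  by rewrite lee_fin mulr_ge0//; have /andP[] := jump01 t px.
transitivity (\esum_(t in C) (a t * jump x t)%:E)%E; last first.
  rewrite esum_mkcond [RHS]esum_mkcond; apply: eq_esum => t _.
  case: ifPn => Ct; first by rewrite ifT//; move: Ct; rewrite !inE => -[].
  case: ifPn => //; rewrite notin_setE in Ct.
  by rewrite aC// mul0r.
transitivity (\int[U]_(z in \bigcup_k (q @^-1` J k)) (a (q z))%:E)%E.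
  rewrite [RHS]integral_mkcond; apply: eq_integral => z _; rewrite patchE.
  case: ifPn => //; rewrite notin_setE -preimage_bigcup UJ => nC.
  by rewrite aC.
rewrite ge0_integral_bigcup//; first last.
- apply/trivIsetP => i j _ _ ij; rewrite -preimage_setI.
  by move/trivIsetP : tJ => /(_ i j I I ij) ->; rewrite preimage_set0.
- by move=> z _; rewrite lee_fin.
- exact: measurable_funTS.
- by move=> k; exact: measurable_preimage_quantile.
rewrite -UJ esum_bigcupT// nneseries_esumT; last first.
  by move=> k; apply: integral_ge0 => z _; rewrite lee_fin.
apply: eq_esum => k _; case: (JE k) => [->|[t ->]].
  by rewrite preimage_set0 integral_set0 esum_set0.
rewrite esum_set1//.
transitivity (\int[U]_(z in q @^-1` [set t]) (a t)%:E)%E.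
  by apply: eq_integral => z; rewrite inE/= => ->.
rewrite integral_cst//; last exact: measurable_preimage_quantile.
by rewrite EFinM; congr (_ * _)%E; exact: quantile_atom.
Qed.

(** The integral and [signed_sum] both split into positive and negative parts. As the jumps of x are
    nonnegative, taking parts commutes with multiplying by them. *)
Lemma integral_quantile_signed_sum (D : set R) (a : R -> R) :
  measurable D -> measurable_fun setT a -> (forall t, jump y t = 0 -> a t = 0) ->
  U.-integrable setT (fun z => ((a \_ D) (q z))%:E) ->
  (\int[U]_z ((a \_ D) (q z))%:E =
   (signed_sum D (fun t => a t * jump x t))%:E)%E.
Proof.
(* The sign s = 1 gives the positive part and s = -1 the negative part, so one computation serves
   both. *)
move=> mD ma ay ia; pose b s t := (Num.max (s * a t) 0).
have mb s : measurable_fun setT (b s \_ D).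
  apply/(measurable_restrictT _ _).1 => //; apply: measurable_funTS.
  by apply: measurable_maxr => //; exact: measurable_funM.
have b0 s t : 0 <= (b s \_ D) t.
  by rewrite patchE; case: ifP => // _; rewrite le_max lexx orbT.
have bE s : (\int[U]_z ((b s \_ D) (q z))%:E =
    \esum_(t in D) (Num.max (s * (a t * jump x t)) 0)%:E)%E.
  rewrite (@integral_quantile_esum D)//.
  - apply: eq_esum => t Dt; rewrite patchE mem_set//; congr (_%:E).
    rewrite /b mulrA; have /andP[j0 _] := jump01 t px.
    by rewrite mulrC maxr_pMr// mulr0 mulrC.
  - by move=> t nD; rewrite patchE memNset.
  - move=> t yt; rewrite patchE; case: ifP => // _.
    by rewrite /b ay// mulr0 maxxx.
pose A z := ((a \_ D) (q z))%:E.
have pE : A^\+%E = (fun z => ((b 1 \_ D) (q z))%:E).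
  apply/funext => z; rewrite funeposE -EFin_max; congr (_%:E).
  by rewrite !patchE; case: ifP => _; rewrite /b ?mul1r// maxxx.
have nE : A^\-%E = (fun z => ((b (-1) \_ D) (q z))%:E).
  apply/funext => z; rewrite funenegE -EFinN -EFin_max; congr (_%:E).
  by rewrite !patchE; case: ifP => _; rewrite /b ?mulN1r// oppr0 maxxx.
have finp : (\esum_(t in D) (Num.max (1 * (a t * jump x t)) 0)%:E)%E \is a fin_num.
  by rewrite -bE -pE; apply: integrable_fin_num => //; exact: integrable_funepos.
have finn : (\esum_(t in D) (Num.max (-1 * (a t * jump x t)) 0)%:E)%E \is a fin_num.
  by rewrite -bE -nE; apply: integrable_fin_num => //; exact: integrable_funeneg.
rewrite integralE -/A pE nE /signed_sum EFinB !bE -(fineK finp) -(fineK finn).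
congr (_%:E - _%:E)%E; congr fine; apply: eq_esum => t _.
  by rewrite mul1r.
by rewrite mulN1r.
Qed.

End jump_sum.

(** Serves the case in which the second player stops first: there the device of the first player is
    integrated out first. *)
Lemma integrable_fubini_G {d1 d2} {T1 : measurableType d1}
    {T2 : measurableType d2} {R : realType}
    (m1 : {sigma_finite_measure set T1 -> \bar R})
    (m2 : {sigma_finite_measure set T2 -> \bar R}) (f : T1 * T2 -> \bar R) :
  (m1 \x m2)%E.-integrable setT f -> m2.-integrable setT (fubini_G m1 f).
Proof.
move=> intf; have mf := measurable_int _ intf.
apply/integrableP; split; first exact: measurable_fubini_G intf.
have := (integrable21ltyP _ _ mf).1 intf; apply: le_lt_trans.
apply: ge0_le_integralT => // y; apply: le_abse_integral => //.
exact: measurableT_comp mf (pair2_measurable y).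
Qed.

Section one_randomised_time.
Context {R : realType}.
Variables (T : R) (T_ge0 : 0 <= T) (x : cumulative R R) (px : unit_path T x).
Local Notation q := (quantile T x).
Local Notation U := (@U01 R).

Lemma integral_cst_event (c m : R) (b : R -> bool) :
  measurable [set z | b z] -> U [set z | b z] = m%:E ->
  (\int[U]_z (c * (b z)%:R)%:E = (c * m)%:E)%E.
Proof.
move=> mb bm; under eq_integral do rewrite natr_indic EFinM.
rewrite integralZl//; last by apply: integrable_indic => //; exact: fin_num_measure.
by rewrite integral_indic// setIT EFinM; congr (_ * _)%E.
Qed.

Lemma quantile_gt_prob (t : R) : U [set z | t < q z] = (1 - x t)%:E.
Proof.
rewrite (_ : [set z | _] = ~` [set z | q z <= t]).
  rewrite probability_setC; last exact: measurable_quantile_le.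
  by rewrite EFinB; congr (_ - _)%E; exact: quantile_cdf.
by apply/seteqP; split => z /=; rewrite ltNge => /negP.
Qed.

Lemma measurable_quantile_gt (t : R) : measurable [set z | t < q z].
Proof.
rewrite (_ : [set z | _] = ~` [set z | q z <= t]).
  by apply: measurableC; exact: measurable_quantile_le.
by apply/seteqP; split => z /=; rewrite ltNge => /negP.
Qed.

(** A quantile may equal T, which [0, T[ omits. The integrands of [accrued] vanish at T because of
    the factor 1 - y_T = 0, so the half-open interval loses nothing. *)
Lemma restrict_quantile (phi : R -> R) (z : R) : phi T = 0 ->
  (phi \_ `[0, T[) (q z) = phi (q z).
Proof.
move=> phiT; rewrite patchE; case: ifPn => //; rewrite notin_setE/= in_itv/=.
have /andP[-> /=] := quantile_itv T_ge0 x z.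
by rewrite le_eqVlt => /predU1P[->|->].
Qed.

End one_randomised_time.

Section two_randomised_times.
Context {R : realType}.
Variables (T : R) (T_ge0 : 0 <= T) (x y : cumulative R R).
Hypotheses (px : unit_path T x) (py : unit_path T y).
Local Notation q := (quantile T x).
Local Notation p := (quantile T y).
Local Notation U := (@U01 R).
Local Notation UU := (U \x U)%E.

(** With z1 fixed, the opponent stops later with probability 1 - y at the time q z1; integrating
    over z1 is then integrating against dx. *)
Lemma integral_first_stops (f : R -> R) : measurable_fun setT f ->
  UU.-integrable setT (fun z => (f (q z.1) * (q z.1 < p z.2)%R%:R)%:E) ->
  (\int[UU]_z (f (q z.1) * (q z.1 < p z.2)%R%:R)%:E =
   (\int[lebesgue_stieltjes_measure x]_(t in `[0%R, T[) (f t * (1 - y t)))%:E)%E.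
Proof.
move=> mf intf; rewrite -(integral12_prod_meas1 intf).
have E : fubini_F U (fun z : R * R => (f (q z.1) * (q z.1 < p z.2)%R%:R)%:E) =
    (fun z => (((fun t => f t * (1 - y t)) \_ `[0, T[) (q z))%:E).
  apply/funext => z1; rewrite /fubini_F/= restrict_quantile//; last first.
    by rewrite py.2// subrr mulr0.
  apply: (@integral_cst_event _ _ _ (fun z2 => q z1 < p z2)).
    exact: measurable_quantile_gt.
  exact: quantile_gt_prob.
have := integrable_fubini_F intf; rewrite E => iE.
rewrite integral_quantile//; apply: measurable_funM => //.
by apply: measurable_funB => //; exact: measurable_cumulative.
Qed.

Lemma integral_second_stops (g : R -> R) : measurable_fun setT g ->
  UU.-integrable setT (fun z => (g (p z.2) * (p z.2 < q z.1)%R%:R)%:E) ->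
  (\int[UU]_z (g (p z.2) * (p z.2 < q z.1)%R%:R)%:E =
   (\int[lebesgue_stieltjes_measure y]_(t in `[0%R, T[) (g t * (1 - x t)))%:E)%E.
Proof.
move=> mg intg; rewrite -(integral21_prod_meas1 intg).
have E : fubini_G U (fun z : R * R => (g (p z.2) * (p z.2 < q z.1)%R%:R)%:E) =
    (fun z => (((fun t => g t * (1 - x t)) \_ `[0, T[) (p z))%:E).
  apply/funext => z2; rewrite /fubini_G/= restrict_quantile//; last first.
    by rewrite px.2// subrr mulr0.
  apply: (@integral_cst_event _ _ _ (fun z1 => p z2 < q z1)).
    exact: measurable_quantile_gt.
  exact: quantile_gt_prob.
have := integrable_fubini_G intg; rewrite E => iE.
rewrite integral_quantile//; apply: measurable_funM => //.
by apply: measurable_funB => //; exact: measurable_cumulative.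
Qed.

(** With z1 fixed, the opponent hits the same time with probability equal to the jump of y there. At
    T this factor need not vanish, hence the separate terminal term. *)
Lemma integral_both_stop (h : R -> R) : measurable_fun setT h ->
  UU.-integrable setT (fun z => (h (q z.1) * (q z.1 == p z.2)%R%:R)%:E) ->
  (\int[UU]_z (h (q z.1) * (q z.1 == p z.2)%R%:R)%:E =
   (signed_sum `[0%R, T[ (fun t => h t * jump x t * jump y t) +
    h T * jump x T * jump y T)%:E)%E.
Proof.
move=> mh inth; rewrite -(integral12_prod_meas1 inth).
pose a t := h t * jump y t.
have E : fubini_F U (fun z : R * R => (h (q z.1) * (q z.1 == p z.2)%R%:R)%:E) =
    (fun z => (a (q z))%:E).
  apply/funext => z1; rewrite /fubini_F/=.
  have S : [set z2 | q z1 == p z2] = [set z2 | p z2 = q z1].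
    by apply/seteqP; split => z /= => [/eqP|->].
  apply: (@integral_cst_event _ _ _ (fun z2 => q z1 == p z2)); rewrite S.
    exact: (measurable_preimage_quantile T_ge0 py (measurable_set1 (q z1))).
  exact: quantile_atom.
have := integrable_fubini_F inth; rewrite E => iE.
have ma : measurable_fun setT a.
  by apply: measurable_funM => //; exact: measurable_jump.
have aE z : a (q z) = (a \_ `[0, T[) (q z) + a T * (q z == T)%R%:R.
  rewrite patchE; case: ifPn; [rewrite inE|rewrite notin_setE]; rewrite /= in_itv/=.
    by move=> /andP[_ qT]; rewrite lt_eqF// mulr0 addr0.
  have /andP[-> /=] := quantile_itv T_ge0 x z.
  by rewrite le_eqVlt => /predU1P[->|->//]; rewrite eqxx mulr1 add0r.
have mT : measurable [set z | q z == T].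
  rewrite (_ : [set z | _] = q @^-1` [set T]); last first.
    by apply/seteqP; split => z /= => [/eqP|->].
  exact: measurable_preimage_quantile.
have iT : U.-integrable setT (fun z => (a T * (q z == T)%R%:R)%:E).
  under eq_fun do rewrite natr_indic EFinM.
  apply: integrableZl => //.
  by apply: integrable_indic => //; exact: fin_num_measure.
have iD : U.-integrable setT (fun z => ((a \_ `[0, T[) (q z))%:E).
  rewrite (_ : (fun _ => _) =
      (fun z => (a (q z))%:E) \- (fun z => (a T * (q z == T)%R%:R)%:E))%E.
    exact: integrableB.
  by apply/funext => z; rewrite /= aE EFinD addeK.
under eq_integral do rewrite aE EFinD.
rewrite integralD// EFinD; congr (_ + _)%E.
  rewrite (@integral_quantile_signed_sum _ _ _ x y)//.
    by congr (signed_sum _ _)%:E; apply/funext => t; rewrite /a mulrAC.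
  by move=> t j0; rewrite /a j0 mulr0.
rewrite (@integral_cst_event _ _ (jump x T) (fun z => q z == T))//.
  by rewrite /a mulrAC.
rewrite -(quantile_atom T_ge0 px); congr (U _).
by apply/seteqP; split => z /= => [/eqP|->].
Qed.

End two_randomised_times.

(** * Decoupling the randomisation devices *)

Section joint_measurability.
Context {R : realType} {d : measure_display} {S : measurableType d}.

(* A right-continuous process is the limit of its samplings at the grid points
   just above [t]. *)
Lemma measurable_right_continuous (V : R -> S -> R) :
  (forall t, measurable_fun setT (V t)) ->
  (forall w t, V s w @[s --> t^'+] --> V t w) ->
  measurable_fun setT (fun p : R * S => V p.1 p.2).
Proof.
(* The shift [k + 1] keeps the grid point strictly above t, as a limit along [t^'+] requires, and at
   most 1 / (n + 1) away. *)
move=> mV rV; pose grid (n : nat) (k : int) : R := (k + 1)%:~R / n.+1%:R.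
pose k (n : nat) (t : R) := Num.floor (t * n.+1%:R).
apply: (@measurable_fun_cvg _ _ _ _ (fun n (p : R * S) => V (grid n (k n p.1)) p.2)).
  move=> n _ B mB; rewrite setTI.
  (* The sampled time takes only countably many values, and on each of them a single V (grid n j) is
     involved. *)
  rewrite (_ : _ @^-1` _ = \bigcup_(j : int)
     ((fun p : R * S => p.1 * n.+1%:R) @^-1` `[j%:~R, (j + 1)%:~R[ `&`
      (snd @^-1` (V (grid n j) @^-1` B)))); last first.
    apply/seteqP; split => [p /= Bp|p [j _ [/=]]].
      by exists (k n p.1) => //; split => //=; rewrite in_itv/= floor_itv.
    by rewrite in_itv/= => /floor_def kj; rewrite /k kj.
  apply: countable_bigcupT_measurable => [|j]; first exact: countableP.
  apply: measurableI.
    rewrite -[X in measurable X]setTI.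
    have : measurable_fun setT (fun p : R * S => p.1 * n.+1%:R).
      by apply: measurable_funM.
    by apply.
  rewrite -[X in measurable X]setTI; apply: measurable_snd => //.
  by rewrite -[X in measurable X]setTI; exact: mV.
move=> [t w] _ /=; have /cvg_at_rightP := rV w t; apply; split.
  move=> n; rewrite /grid ltr_pdivlMr//.
  by have /andP[] := floor_itv (t * n.+1%:R).
apply: (@squeeze_cvgr _ _ _ _ (cst t) (fun n => t + n.+1%:R^-1)).
- apply: nearW => n; rewrite /grid; apply/andP; split.
    rewrite ler_pdivlMr// ltW//.
    by have /andP[] := floor_itv (t * n.+1%:R).
  rewrite ler_pdivrMr// mulrDl mulVf// intrD lerD2r.
  by have /andP[] := floor_itv (t * n.+1%:R).
- exact: cvg_cst.
- rewrite -[X in _ --> X]addr0; apply: cvgD; first exact: cvg_cst.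
  exact: cvg_harmonic.
Qed.

End joint_measurability.

Section clamped_time.
Context {R : realType} (T : R) (T_ge0 : 0 <= T).

(** The payoff processes are controlled on [0, T] only; composing with [clamp] extends them to
    right-continuous functions on the whole line. *)
Definition clamp (t : R) : R := Num.max 0 (Num.min t T).

Lemma clamp_itv t : 0 <= clamp t <= T.
Proof. by rewrite /clamp le_max lexx ge_max T_ge0 ge_min lexx orbT. Qed.

Lemma clamp_id t : 0 <= t <= T -> clamp t = t.
Proof. by move=> /andP[t0 tT]; rewrite /clamp min_l// max_r. Qed.

Lemma cadlag_clamp (u : R -> R) t : cadlag_path T u ->
  u (clamp s) @[s --> t^'+] --> u (clamp t).
Proof.
move=> [uR _]; have [t0|t0] := ltP t 0.
  apply: cvg_near_cst; near=> s; congr u; rewrite /clamp.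
  have s0 : s < 0 by near: s; exact: nbhs_right_lt.
  rewrite !min_l ?max_l// ltW//; exact: lt_le_trans T_ge0.
have [tT|tT] := ltP t T; last first.
  apply: cvg_near_cst; near=> s; congr u; rewrite /clamp.
  by rewrite !min_r// (le_trans tT)// ltW//; near: s; exact: nbhs_right_gt.
rewrite clamp_id ?t0 ?ltW//.
apply: cvg_trans (uR t _); last by rewrite t0.
apply: near_eq_cvg; near=> s; rewrite clamp_id//; apply/andP; split.
  by apply: (le_trans t0); apply: ltW; near: s; exact: nbhs_right_gt.
by apply: ltW; near: s; exact: nbhs_right_lt.
Unshelve. all: by end_near. Qed.

End clamped_time.

Section decoupling.
Context {d : measure_display} {Omega : measurableType d} {R : realType}.
Variables (P : probability Omega R) (G : set (set Omega)).
Hypothesis sG : is_sub_sigma_algebra G.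
Variables (Z1 Z2 : {RV P >-> R}).
Hypotheses (uZ1 : uniform01 Z1) (uZ2 : uniform01 Z2)
  (indep : independent3 G Z1 Z2).
Local Notation TG := (g_sigma_algebraType G).
Local Notation U := (@U01 R).
Local Notation UU := [the probability _ _ of (U \x U)%E].

Definition prob_wrt : probability TG R :=
  distribution P (mfun_pack (measurable_id_wrt sG)).
Local Notation PG := prob_wrt.

(** The state is kept with the sigma-algebra G only, since it is from G that the devices are
    independent. *)
Definition draw (w : Omega) : TG * (R * R) := (w, (Z1 w, Z2 w)).

Lemma measurable_draw : measurable_fun setT draw.
Proof.
apply: measurable_fun_pair; first exact: measurable_id_wrt.
by apply: measurable_fun_pair; exact: measurable_funPT.
Qed.

(** Conditioned on A, the pair of devices has the mass of U x U on rectangles by independence, so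
    uniqueness of the product measure gives all Borel sets. *)
Lemma devices_law (A : set Omega) (B : set (R * R)) : G A -> measurable B ->
  (P (A `&` (fun w => (Z1 w, Z2 w)) @^-1` B) = P A * UU B)%E.
Proof.
move=> GA mB; have mA : measurable A by exact: sG.2.
pose Z w := (Z1 w, Z2 w).
have mZ : measurable_fun setT Z.
  by apply: measurable_fun_pair; exact: measurable_funPT.
have mZB : measurable (Z @^-1` B) by rewrite -[X in measurable X]setTI; exact: mZ.
(* Normalising by P A requires a nonzero mass; for a null A both sides are 0. *)
have [PA0|PA0] := eqVneq (P A) 0%E.
  rewrite PA0 mul0e; apply/eqP; rewrite eq_le measure_ge0 andbT -PA0.
  by apply: le_measure; rewrite ?inE//; exact: measurableI.
have cE : P A = (fine (P A))%:E by rewrite fineK// fin_num_measure.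
have c0 : 0 < fine (P A).
  by rewrite -lte_fin -cE lt_neqAle eq_sym PA0 measure_ge0.
have ic0 : 0 <= (fine (P A))^-1 by rewrite invr_ge0 ltW.
pose m0 := [the measure _ _ of pushforward (mrestr P mA) (Z : Omega -> (R * R)%type)].
pose m' := mscale (NngNum ic0) (m0 mZ).
have m'E (C : set (R * R)) : measurable C ->
    m' C = (((fine (P A))^-1)%:E * P (A `&` Z @^-1` C))%E.
  by move=> mC; rewrite /m' /mscale/= /pushforward/= /mrestr setIC.
have <- : (P A * m' B = P (A `&` Z @^-1` B))%E.
  by rewrite m'E// muleA {1}cE -EFinM mulfV ?gt_eqF// mul1e.
congr (_ * _)%E; apply/esym/product_measure_unique => // B1 B2 mB1 mB2.
transitivity (((fine (P A))^-1)%:E * P (A `&` Z @^-1` (B1 `*` B2)))%E.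
  by apply: m'E; exact: measurableX.
have -> : A `&` Z @^-1` (B1 `*` B2) = A `&` Z1 @^-1` B1 `&` Z2 @^-1` B2.
  by rewrite -setIA.
have cK : (((fine (P A))^-1)%:E * P A = 1)%E.
  by rewrite [X in (_ * X)%E]cE -EFinM mulVf// gt_eqF.
rewrite indep// -(muleA (P A)) (muleA ((fine (P A))^-1)%:E) cK mul1e.
by congr (_ * _)%E; [rewrite -[LHS]/(distribution P Z1 B1) uZ1|
  rewrite -[LHS]/(distribution P Z2 B2) uZ2].
Qed.

Lemma draw_law (X : set (TG * (R * R))) : measurable X ->
  ((PG \x UU) X = P (draw @^-1` X))%E.
Proof.
move=> mX; rewrite (@product_measure_unique _ _ _ _ _ PG UU
  (distribution P (mfun_pack measurable_draw)))// => A B mA mB.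
rewrite measurable_gE in mA => //.
by rewrite -devices_law.
Qed.

Section integral.
Variable psi : TG * (R * R) -> R.
Hypotheses (mpsi : measurable_fun setT psi)
  (ipsi : P.-integrable setT (fun w => (psi (draw w))%:E)).

Lemma integrable_draw : (PG \x UU)%E.-integrable setT (EFin \o psi).
Proof.
have mEpsi : measurable_fun setT (EFin \o psi) by exact/measurable_EFinP.
apply/integrableP; split => //.
have /integrableP[_] := ipsi; apply: le_lt_trans.
rewrite -(@ge0_integral_distribution _ _ _ _ _ P (mfun_pack measurable_draw)
  (fun z => `|(psi z)%:E|%E))//; last exact: measurableT_comp.
rewrite le_eqVlt; apply/orP; left; apply/eqP.
by apply: eq_measure_integral => A mA _; exact: draw_law.
Qed.

Lemma ae_integrable_draw :
  {ae P, forall w, UU.-integrable setT (fun z => (psi (w, z))%:E)}.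
Proof.
have [N [mN PN0 subN]] := ae_integrable1 integrable_draw.
exists N; split => //; apply: sG.2; rewrite -(measurable_gE sG); exact: mN.
Qed.

(* The expectation of [psi] given [G], up to a null event. *)
Definition decoupled (w : Omega) : R := fine (fubini_F UU (EFin \o psi) w).

Lemma decoupledE : {ae P, forall w,
  (\int[UU]_z (psi (w, z))%:E)%E = (decoupled w)%:E}.
Proof.
have FF := ae_filter_ringOfSetsType P.
apply: filterS ae_integrable_draw => w iw.
by rewrite /decoupled fineK//; exact: integrable_fin_num.
Qed.

Lemma measurable_decoupled : measurable_fun setT decoupled.
Proof.
have mF := measurable_fubini_F integrable_draw.
exact: (measurableT_comp (@fine_measurable R setT measurableT)
  (measurableT_comp mF (measurable_id_wrt sG))).
Qed.

Let F := fubini_F UU (EFin \o psi).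

Let iF : PG.-integrable setT F.
Proof. exact: integrable_fubini_F integrable_draw. Qed.

Let iFP : P.-integrable setT F.
Proof.
have mF := measurable_int _ iF; apply/integrableP; split.
  exact: measurableT_comp mF (measurable_id_wrt sG).
have /integrableP[_] := iF; rewrite ge0_integral_distribution//.
exact: measurableT_comp.
Qed.

Let FE : ae_eq P setT F (EFin \o decoupled).
Proof.
have FF := ae_filter_ringOfSetsType P.
by apply: filterS decoupledE => w wE _; exact: wE.
Qed.

Lemma integrable_decoupled : P.-integrable setT (EFin \o decoupled).
Proof.
have mD : measurable_fun setT (EFin \o decoupled).
  by apply/measurable_EFinP; exact: measurable_decoupled.
apply/integrableP; split => //.
have /integrableP[mF] := iFP; apply: le_lt_trans.
rewrite le_eqVlt; apply/orP; left; apply/eqP; apply: ae_eq_integral => //.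
- exact: measurableT_comp.
- exact: measurableT_comp.
- by apply/ae_eq_sym/ae_eq_abse.
Qed.

(** The law of [draw] is a product by [draw_law], so Fubini integrates the devices out first and
    leaves an integral over the state. *)
Lemma integral_draw :
  (\int[P]_w (psi (draw w))%:E = \int[P]_w (decoupled w)%:E)%E.
Proof.
have mEpsi : measurable_fun setT (EFin \o psi) by exact/measurable_EFinP.
have mD : measurable_fun setT (EFin \o decoupled).
  by apply/measurable_EFinP; exact: measurable_decoupled.
transitivity (\int[PG \x UU]_z (EFin \o psi) z)%E.
  transitivity (\int[distribution P (mfun_pack measurable_draw)]_z (EFin \o psi) z)%E.
    by rewrite integral_distribution.
  by apply: eq_measure_integral => A mA _; apply/esym; exact: draw_law.
rewrite -(integral12_prod_meas1 integrable_draw).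
transitivity (\int[P]_w F w)%E.
  rewrite /prob_wrt integral_distribution//.
  exact: measurable_int iF.
apply: ae_eq_integral => //; exact: measurable_int iFP.
Qed.

End integral.

End decoupling.

(** Completeness supplies the measurability of g; this is the route to the integrability of
    [accrued]. *)
Lemma ae_eq_integrable {d} {T : measurableType d} {R : realType}
    (mu : {measure set T -> \bar R}) (f g : T -> \bar R) :
  measure_is_complete mu -> ae_eq mu setT f g ->
  mu.-integrable setT f -> mu.-integrable setT g.
Proof.
move=> cmu fg intf; have mf := measurable_int _ intf.
have mg : measurable_fun setT g by exact: ae_measurable_fun fg mf.
apply/integrableP; split => //.
have /integrableP[_] := intf; apply: le_lt_trans.
rewrite le_eqVlt; apply/orP; left; apply/eqP; apply: ae_eq_integral => //.
- exact: measurableT_comp.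
- exact: measurableT_comp.
- by apply/ae_eq_sym/ae_eq_abse.
Qed.

(** * Expected payoff as accrued payoff plus a terminal jump term *)

Section expected_payoff.
Context {d : measure_display} {Omega : measurableType d} {R : realType}.
Variables (P : probability Omega R) (T : R) (T_ge0 : 0 <= T).
Variables (G : set (set Omega)) (sG : is_sub_sigma_algebra G).
Variables (f g h : R -> Omega -> R).
Local Notation TG := (g_sigma_algebraType G).
Local Notation UU := [the probability _ _ of ((@U01 R) \x (@U01 R))%E].

Lemma measurable_wrt_left_lim (rho : Omega -> cumulative R R) (t : R) :
  (forall s, measurable_wrt G (fun w => rho w s)) ->
  measurable_wrt G (fun w => left_lim (rho w) t).
Proof.
move=> mrho.
apply: (@measurable_fun_cvg _ _ _ _ (fun n (w : TG) => rho w (t - n.+1%:R^-1))).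
  by move=> n; exact: mrho.
move=> w _; have /cvg_at_leftP := @left_lim_cvg _ (rho w) t; apply; split.
  by move=> n; rewrite ltrBlDr ltrDl invr_gt0.
rewrite -[X in _ --> X]subr0; apply: cvgB; first exact: cvg_cst.
exact: cvg_harmonic.
Qed.

Lemma measurable_wrt_jump (rho : Omega -> cumulative R R) (t : R) :
  (forall s, measurable_wrt G (fun w => rho w s)) ->
  measurable_wrt G (fun w => jump (rho w) t).
Proof.
by move=> mrho; apply: measurable_funB; [exact: mrho|exact: measurable_wrt_left_lim].
Qed.

Hypotheses (f_cadlag : forall w, cadlag_path T (f ^~ w))
  (g_cadlag : forall w, cadlag_path T (g ^~ w))
  (h_cadlag : forall w, cadlag_path T (h ^~ w)).
Hypotheses (mf : forall t, 0 <= t <= T -> measurable_wrt G (f t))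
  (mg : forall t, 0 <= t <= T -> measurable_wrt G (g t))
  (mh : forall t, 0 <= t <= T -> measurable_wrt G (h t)).
Hypothesis fgh_integrable : integrable_sup P T f g h.
Variables (x y : Omega -> cumulative R R).
Hypotheses (px : forall w, unit_path T (x w)) (py : forall w, unit_path T (y w)).
Hypotheses (mx : forall t, measurable_wrt G (fun w => x w t))
  (my : forall t, measurable_wrt G (fun w => y w t)).

Let mq : measurable_fun setT (fun v : TG * (R * R) => quantile T (x v.1) v.2.1).
Proof.
have mz : measurable_fun setT (fun v : TG * (R * R) => (v.1, v.2.1) : TG * R).
  by apply: measurable_fun_pair => //; exact: measurableT_comp.
exact: (measurableT_comp (@measurable_quantile R T T_ge0 _ TG x px mx) mz).
Qed.

Let mp : measurable_fun setT (fun v : TG * (R * R) => quantile T (y v.1) v.2.2).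
Proof.
have mz : measurable_fun setT (fun v : TG * (R * R) => (v.1, v.2.2) : TG * R).
  by apply: measurable_fun_pair => //; exact: measurableT_comp.
exact: (measurableT_comp (@measurable_quantile R T T_ge0 _ TG y py my) mz).
Qed.

Let mclamp (u : R -> Omega -> R) (tau : TG * (R * R) -> R) :
  (forall w, cadlag_path T (u ^~ w)) ->
  (forall t, 0 <= t <= T -> measurable_wrt G (u t)) ->
  measurable_fun setT tau ->
  measurable_fun setT (fun v : TG * (R * R) => u (clamp T (tau v)) v.1).
Proof.
move=> u_cadlag mu mtau.
have mV : measurable_fun setT (fun p : R * TG => u (clamp T p.1) p.2).
 apply: (@measurable_right_continuous R _ TG (fun t w => u (clamp T t) w)).
    by move=> t; apply: mu; exact: clamp_itv.
  by move=> w t; exact: (cadlag_clamp T_ge0 (u_cadlag w)).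
have mz : measurable_fun setT (fun v : TG * (R * R) => (tau v, v.1) : R * TG).
  exact: measurable_fun_pair.
exact: (measurableT_comp mV mz).
Qed.

Let mnatr (b : TG * (R * R) -> bool) : measurable_fun setT b ->
  measurable_fun setT (fun v => (b v)%:R : R).
Proof.
move=> mb; have mR : measurable_fun setT (fun c : bool => c%:R : R) by [].
exact: measurableT_comp mR mb.
Qed.

Let psif (v : TG * (R * R)) : R := f (clamp T (quantile T (x v.1) v.2.1)) v.1 *
  (quantile T (x v.1) v.2.1 < quantile T (y v.1) v.2.2)%R%:R.
Let psih (v : TG * (R * R)) : R := h (clamp T (quantile T (x v.1) v.2.1)) v.1 *
  (quantile T (x v.1) v.2.1 == quantile T (y v.1) v.2.2)%R%:R.
Let psig (v : TG * (R * R)) : R := g (clamp T (quantile T (y v.1) v.2.2)) v.1 *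
  (quantile T (y v.1) v.2.2 < quantile T (x v.1) v.2.1)%R%:R.

Let mpsif : measurable_fun setT psif.
Proof.
apply: measurable_funM; first exact: mclamp.
by apply: mnatr; exact: measurable_fun_ltr.
Qed.

Let mpsih : measurable_fun setT psih.
Proof.
apply: measurable_funM; first exact: mclamp.
by apply: mnatr; exact: measurable_fun_eqr.
Qed.

Let mpsig : measurable_fun setT psig.
Proof.
apply: measurable_funM; first exact: mclamp.
by apply: mnatr; exact: measurable_fun_ltr.
Qed.

(** The dominating time may depend on the state, which covers payoffs evaluated at random times. *)
Lemma integrable_dominated_sup (X : Omega -> R) : measurable_fun setT X ->
  (forall w, exists2 t, 0 <= t <= T & `|X w| <= `|f t w| + `|g t w| + `|h t w|) ->
  P.-integrable setT (EFin \o X).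
Proof.
move=> mX domX; apply/integrableP; split; first exact/measurable_EFinP.
apply: le_lt_trans fgh_integrable; apply: ge0_le_integralT => // w /=.
have [t t0T Xt] := domX w.
apply: (@le_trans _ _ (`|f t w| + `|g t w| + `|h t w|)%:E).
  by rewrite lee_fin.
by apply: ereal_sup_ubound; exists t => //=; rewrite in_itv.
Qed.

(** Grouped as own jump times (opponent's jump times h_T), the form in which [integral_cond_expD]
    pulls out the first factor. *)
Let J w := jump (x w) T * (jump (y w) T * h T w).

Lemma integrable_terminal_jump (z : Omega -> cumulative R R) :
  (forall w, unit_path T (z w)) -> (forall t, measurable_wrt G (fun w => z w t)) ->
  P.-integrable setT (EFin \o (fun w => jump (z w) T * h T w)).
Proof.
move=> pz mz; apply: integrable_dominated_sup.
  apply: measurable_funM; apply: (measurable_wrtW sG).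
    exact: measurable_wrt_jump.
  by apply: mh; rewrite T_ge0 lexx.
move=> w; exists T; first by rewrite T_ge0 lexx.
have /andP[j0 j1] := jump01 T (pz w).
rewrite normrM (ger0_norm j0); apply: (@le_trans _ _ `|h T w|).
  by rewrite ler_piMl.
by rewrite lerDr addr_ge0.
Qed.

Let iJ : P.-integrable setT (EFin \o J).
Proof.
apply: integrableM01.
- by apply: (measurable_wrtW sG); exact: measurable_wrt_jump.
- by move=> w; exact: jump01.
- exact: integrable_terminal_jump.
Qed.

Variables (Z1 Z2 : {RV P >-> R}).
Hypotheses (uZ1 : uniform01 Z1) (uZ2 : uniform01 Z2)
  (indep : independent3 G Z1 Z2).
Local Notation dr := (draw G Z1 Z2).

Let dom (psi : TG * (R * R) -> R) (u : R -> Omega -> R) (tau : TG * (R * R) -> R)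
  (b : TG * (R * R) -> bool) : measurable_fun setT psi ->
  (forall t w, `|u t w| <= `|f t w| + `|g t w| + `|h t w|) ->
  (forall v, psi v = u (clamp T (tau v)) v.1 * (b v)%:R) ->
  P.-integrable setT (fun w => (psi (dr w))%:E).
Proof.
move=> mpsi udom psiE; apply: (@integrable_dominated_sup (psi \o dr)).
  exact: measurableT_comp mpsi (measurable_draw sG _ _).
move=> w; exists (clamp T (tau (dr w))); first exact: clamp_itv.
apply: le_trans (udom _ _); rewrite /= psiE normrM ler_piMr//.
by case: (b _); rewrite ?normr1// normr0.
Qed.

Let ipsif : P.-integrable setT (fun w => (psif (dr w))%:E).
Proof.
apply: (@dom psif f (fun v => quantile T (x v.1) v.2.1)
  (fun v => quantile T (x v.1) v.2.1 < quantile T (y v.1) v.2.2)) => // t w.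
by rewrite -addrA lerDl addr_ge0.
Qed.

Let ipsig : P.-integrable setT (fun w => (psig (dr w))%:E).
Proof.
apply: (@dom psig g (fun v => quantile T (y v.1) v.2.2)
  (fun v => quantile T (y v.1) v.2.2 < quantile T (x v.1) v.2.1)) => // t w.
by rewrite addrAC lerDr addr_ge0.
Qed.

Let ipsih : P.-integrable setT (fun w => (psih (dr w))%:E).
Proof.
apply: (@dom psih h (fun v => quantile T (x v.1) v.2.1)
  (fun v => quantile T (x v.1) v.2.1 == quantile T (y v.1) v.2.2)) => // t w.
by rewrite lerDr addr_ge0.
Qed.

Let Df := decoupled psif.
Let Dg := decoupled psig.
Let Dh := decoupled psih.

Let payoff_draw : payoff f g h (rand_time T x Z1) (rand_time T y Z2) =
  (fun w => psif (dr w) + psih (dr w) + psig (dr w)).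
Proof.
apply/funext => w; rewrite /payoff /psif /psih /psig /=.
by rewrite !clamp_id//; exact: quantile_itv.
Qed.

Let expected_payoff_decoupled :
  expected_payoff P f g h (rand_time T x Z1) (rand_time T y Z2) =
  (\int[P]_w (Df w + Dh w + Dg w)%:E)%E.
Proof.
rewrite /expected_payoff payoff_draw unlock.
under eq_integral do rewrite !EFinD.
rewrite integralD//; last exact: integrableD.
rewrite integralD//.
have E psi : measurable_fun setT psi ->
    P.-integrable setT (fun w => (psi (dr w))%:E) ->
    (\int[P]_w (psi (dr w))%:E = \int[P]_w (decoupled psi w)%:E)%E.
  by move=> mpsi ipsi; apply: integral_draw.
have I psi : measurable_fun setT psi ->
    P.-integrable setT (fun w => (psi (dr w))%:E) ->
    P.-integrable setT (EFin \o decoupled psi).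
  by move=> mpsi ipsi; apply: (integrable_decoupled sG uZ1 uZ2 indep).
rewrite !E//; under [RHS]eq_integral do rewrite !EFinD.
rewrite [RHS]integralD//; [|by apply: integrableD => //; exact: I|exact: I].
by rewrite [in RHS]integralD//; exact: I.
Qed.

Lemma eq_signed_sum (A : set R) (a b : R -> R) :
  (forall t, A t -> a t = b t) -> signed_sum A a = signed_sum A b.
Proof.
move=> ab; rewrite /signed_sum.
by congr (fine _ - fine _); apply: eq_esum => t At; rewrite ab.
Qed.

(** Outside a null event the three sections are integrable over the square of devices, so the
    formulas for a fixed path apply; the terminal part of the simultaneous case is [J]. *)
Let decoupled_accrued : {ae P, forall w, Df w + Dh w + Dg w =
  accrued f g h x y (fun=> T) w + J w}.
Proof.
have FF := ae_filter_ringOfSetsType P.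
have I psi : measurable_fun setT psi ->
    P.-integrable setT (fun w => (psi (dr w))%:E) ->
    {ae P, forall w, UU.-integrable setT (fun z => (psi (w, z))%:E)}.
  by move=> mpsi ipsi; apply: (ae_integrable_draw sG uZ1 uZ2 indep).
have sec (u : R -> Omega -> R) w : (forall w, cadlag_path T (u ^~ w)) ->
    (forall t, 0 <= t <= T -> measurable_wrt G (u t)) ->
    measurable_fun setT (fun t => u (clamp T t) w).
  move=> u_cadlag mu.
  have mV : measurable_fun setT (fun p : R * TG => u (clamp T p.1) p.2).
    apply: (@measurable_right_continuous R _ TG (fun t w => u (clamp T t) w)).
      by move=> t; apply: mu; exact: clamp_itv.
    by move=> w' t; exact: (cadlag_clamp T_ge0 (u_cadlag w')).
  exact: (measurableT_comp mV (pair2_measurable (w : TG))).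
have inD t : `[0%R, T[%classic t -> clamp T t = t.
  by rewrite /= in_itv/= => /andP[t0 tT]; rewrite clamp_id// t0 ltW.
apply: filterS3 (I _ mpsif ipsif) (I _ mpsig ipsig) (I _ mpsih ipsih).
move=> w iF iG iH.
have Ef := integral_first_stops T_ge0 (px w) (py w) (sec f w f_cadlag mf) iF.
have Eg := integral_second_stops T_ge0 (px w) (py w) (sec g w g_cadlag mg) iG.
have Eh := integral_both_stop T_ge0 (px w) (py w) (sec h w h_cadlag mh) iH.
have -> : Df w = \int[lebesgue_stieltjes_measure (x w)]_(t in `[0%R, T[)
    (f t w * (1 - y w t)).
  rewrite /Df /decoupled; transitivity (fine (\int[UU]_z (psif (w, z))%:E)%E) => //.
  rewrite Ef /=; apply: eq_Rintegral => t; rewrite inE => /inD ->//.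
have -> : Dg w = \int[lebesgue_stieltjes_measure (y w)]_(t in `[0%R, T[)
    (g t w * (1 - x w t)).
  rewrite /Dg /decoupled; transitivity (fine (\int[UU]_z (psig (w, z))%:E)%E) => //.
  rewrite Eg /=; apply: eq_Rintegral => t; rewrite inE => /inD ->//.
have -> : Dh w = signed_sum `[0%R, T[
    (fun t => h t w * jump (x w) t * jump (y w) t) + J w.
  rewrite /Dh /decoupled; transitivity (fine (\int[UU]_z (psih (w, z))%:E)%E) => //.
  rewrite Eh /= clamp_id ?T_ge0 ?lexx//; congr (_ + _).
    by apply: eq_signed_sum => t /inD ->.
  by rewrite /J; ring.
rewrite /accrued; ring.
Qed.

Hypothesis P_complete : measure_is_complete P.

Let iD : P.-integrable setT (EFin \o (fun w => Df w + Dh w + Dg w)).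
Proof.
have I psi : measurable_fun setT psi ->
    P.-integrable setT (fun w => (psi (dr w))%:E) ->
    P.-integrable setT (EFin \o decoupled psi).
  by move=> mpsi ipsi; apply: (integrable_decoupled sG uZ1 uZ2 indep).
rewrite (_ : EFin \o _ =
    ((EFin \o Df) \+ (EFin \o Dh)) \+ (EFin \o Dg))%E//.
by apply: integrableD; [|apply: integrableD|]; rewrite //; exact: I.
Qed.

Lemma integrable_accrued :
  P.-integrable setT (EFin \o accrued f g h x y (fun=> T)).
Proof.
have FF := ae_filter_ringOfSetsType P.
have : P.-integrable setT ((EFin \o (fun w => Df w + Dh w + Dg w)%R) \- (EFin \o J))%E.
  exact: integrableB.
apply: ae_eq_integrable => //.
apply: filterS decoupled_accrued => w wE _ /=.
by rewrite wE EFinD addeK.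
Qed.

Lemma expected_payoffE :
  expected_payoff P f g h (rand_time T x Z1) (rand_time T y Z2) =
  (\int[P]_w (accrued f g h x y (fun=> T) w +
    jump (x w) T * (jump (y w) T * h T w))%:E)%E.
Proof.
have FF := ae_filter_ringOfSetsType P.
rewrite expected_payoff_decoupled; apply: ae_eq_integral => //.
- exact: measurable_int iD.
- rewrite (_ : (fun _ => _) =
      (EFin \o accrued f g h x y (fun=> T)) \+ (EFin \o J))%E//.
  apply: emeasurable_funD; first exact: measurable_int integrable_accrued.
  exact: measurable_int iJ.
- by apply: filterS decoupled_accrued => w wE _; rewrite /= wE.
Qed.

End expected_payoff.

(** * Martingale systems at the terminal dates *)

Section constant_times.
Context {d : measure_display} {Omega : measurableType d} {R : realType}.
Variables (P : probability Omega R) (T : R) (F : R -> set (set Omega)).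
Hypotheses (T_ge0 : 0 <= T) (F_filtration : filtration P T F).

Lemma filtration_sub (t : R) : 0 <= t <= T -> is_sub_sigma_algebra (F t).
Proof. by case: F_filtration => sF _ _ _; exact: sF. Qed.

Lemma filtration_T (t : R) : 0 <= t <= T -> F t `<=` F T.
Proof.
by case: F_filtration => _ incF _ _ /andP[t0 tT]; exact: incF.
Qed.

Lemma stopping_time_cst (c : R) : 0 <= c <= T -> stopping_time T F (fun=> c).
Proof.
move=> c0T; split => // t t0T; rewrite -(measurable_gE (filtration_sub t0T)).
have [ct|tc] := leP c t.
  rewrite (_ : [set _ | _] = setT); first exact: measurableT.
  by apply/seteqP; split.
rewrite (_ : [set _ | _] = set0); first exact: measurable0.
by rewrite -subset0.
Qed.

Lemma stopped_cst (c : R) : 0 <= c <= T -> stopped T F (fun=> c) = F c.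
Proof.
move=> c0T; have /andP[c0 cT] := c0T; apply/seteqP; split => [A [mA At]|A FA].
  have := At c c0T; rewrite (_ : [set _ | _] = setT) ?setIT//.
  by apply/seteqP; split => // w _ /=.
split => [|t t0T]; first exact: (filtration_sub c0T).2.
have /andP[t0 tT] := t0T.
have [ct|tc] := leP c t.
  rewrite (_ : [set _ | _] = setT) ?setIT; last by apply/seteqP; split.
  by case: F_filtration => _ incF _ _; exact: incF FA.
rewrite (_ : [set _ | _] = set0) ?setI0; last first.
  by rewrite -subset0.
by rewrite -(measurable_gE (filtration_sub t0T)); exact: measurable0.
Qed.

Lemma generating_unit_path (rho : Omega -> cumulative R R) w :
  generating T F rho -> unit_path T (rho w).
Proof. by move=> [rho0 rho1 _]; split => t; [exact: rho0|exact: rho1]. Qed.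

Lemma measurable_wrt_sub (G1 G2 : set (set Omega)) (X : Omega -> R) :
  G1 `<=` G2 -> measurable_wrt G1 X -> measurable_wrt G2 X.
Proof.
move=> G12 mX _ A mA; apply: (sub_sigma_algebra2 G12).
exact: mX measurableT _ mA.
Qed.

(** [G] will be the terminal sigma-algebra of the full filtration when payoffs are computed, and the
    player's own when the jump at T is pulled out. Adaptedness covers times in [0, T]; elsewhere the
    paths are constant in the state. *)
Lemma generating_measurable_wrt (G : set (set Omega))
    (rho : Omega -> cumulative R R) (t : R) :
  F T `<=` G -> generating T F rho -> measurable_wrt G (fun w => rho w t).
Proof.
move=> FG [rho0 rho1 mrho].
have [t0|t0] := ltP t 0.
  rewrite (_ : (fun _ => _) = cst 0); first exact: measurable_cst.
  by apply/funext => w; exact: rho0.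
have [tT|tT] := leP T t.
  rewrite (_ : (fun _ => _) = cst 1); first exact: measurable_cst.
  by apply/funext => w; exact: rho1.
have t0T : 0 <= t <= T by rewrite t0 ltW.
apply: measurable_wrt_sub (mrho _ t0T).
exact: subset_trans (filtration_T t0T) FG.
Qed.

Lemma progressive0 (V : R -> Omega -> R) : progressive T F V ->
  measurable_fun setT (V 0).
Proof.
have T0 : (0 : R) <= 0 <= T by apply/andP; split.
move=> /(_ 0 T0) mV.
apply: (measurable_wrtW (filtration_sub T0)).
apply: (measurable_comp _ _ mV (pair1_measurable (0 : measurableTypeR R))).
  by apply: measurableX.
by move=> _ [w _ <-]; split => //=; rewrite in_itv/= lexx.
Qed.

End constant_times.

Section ae_integrals.
Context {d : measure_display} {Omega : measurableType d} {R : realType}.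
Variable P : probability Omega R.
Implicit Types X Y : Omega -> R.

Lemma ae_eq_integral_EFin X Y : measurable_fun setT X -> measurable_fun setT Y ->
  {ae P, forall w, X w = Y w} ->
  (\int[P]_w (X w)%:E = \int[P]_w (Y w)%:E)%E.
Proof.
have FF := ae_filter_ringOfSetsType P.
move=> mX mY XY; apply: ae_eq_integral => //.
- exact/measurable_EFinP.
- exact/measurable_EFinP.
- by apply: filterS XY => w -> _.
Qed.

Lemma ae_le_integral X Y : P.-integrable setT (EFin \o X) ->
  P.-integrable setT (EFin \o Y) -> {ae P, forall w, X w <= Y w} ->
  (\int[P]_w (X w)%:E <= \int[P]_w (Y w)%:E)%E.
Proof.
have FF := ae_filter_ringOfSetsType P.
move=> iX iY XY; rewrite -sube_ge0; last by apply/orP; left; exact: integrable_fin_num iX.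
have /= <- := integralB measurableT iY iX.
have mXY : measurable_fun setT (fun w => ((Y w)%:E - (X w)%:E)%E).
  exact: measurable_int (integrableB measurableT iY iX).
(* The difference is nonnegative only almost everywhere, so it is replaced by its absolute value. *)
rewrite (ae_eq_integral (fun w => `|(Y w)%:E - (X w)%:E|)%E)//.
- by apply: integral_ge0 => w _; exact: abse_ge0.
- exact: measurableT_comp.
- by apply: filterS XY => w XYw _; apply/esym/gee0_abs; rewrite sube_ge0// lee_fin.
Qed.

Lemma cond_exp_cst (G : set (set Omega)) (c : R) : is_sub_sigma_algebra G ->
  {ae P, forall w, cond_exp P G (fun=> c) w = c}.
Proof.
move=> sG; have ic : P.-integrable setT (EFin \o (fun=> c : R)).
  exact: finite_measure_integrable_cst.
apply: (cond_exp_unique sG (cond_expP sG ic)); split => //.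
exact: measurable_cst.
Qed.

End ae_integrals.

Section optimal_bounds.
Context {d : measure_display} {Omega : measurableType d} {R : realType}.
Variables (P : probability Omega R) (T : R) (F : R -> set (set Omega)).
Hypotheses (T_ge0 : 0 <= T) (F_filtration : filtration P T F).
Variables (M : (Omega -> R) -> Omega -> R) (V0 VT : Omega -> R).
Hypotheses (mV0 : measurable_fun setT V0) (mVT : measurable_fun setT VT).
Hypotheses (M0 : {ae P, forall w, M (fun=> 0) w = V0 w})
  (MT : {ae P, forall w, M (fun=> T) w = VT w}).

Let s0 : stopping_time T F (fun=> 0).
Proof. by apply: (stopping_time_cst F_filtration); apply/andP; split. Qed.

Let sT : stopping_time T F (fun=> T).
Proof. by apply: (stopping_time_cst F_filtration); rewrite T_ge0 lexx. Qed.

Let sF0 : is_sub_sigma_algebra (stopped T F (fun=> 0)).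
Proof.
have T0 : (0 : R) <= 0 <= T by apply/andP; split.
by rewrite (stopped_cst F_filtration T0); exact: (filtration_sub F_filtration T0).
Qed.

Let integral_at c V : measurable_fun setT V ->
  P.-integrable setT (EFin \o M (fun=> c)) ->
  {ae P, forall w, M (fun=> c) w = V w} ->
  (\int[P]_w (M (fun=> c) w)%:E = \int[P]_w (V w)%:E)%E.
Proof.
move=> mV iM ME; apply: ae_eq_integral_EFin => //.
by apply/measurable_EFinP; exact: measurable_int iM.
Qed.

(** [V0] and [VT] are explicit representatives of the system at 0 and T, where its values are known
    only almost surely. *)
Lemma submartingale_system_le : submartingale_system P T F M ->
  (\int[P]_w (V0 w)%:E <= \int[P]_w (VT w)%:E)%E.
Proof.
move=> [_ iM leM].
rewrite -(integral_at mV0 (iM _ s0) M0) -(integral_at mVT (iM _ sT) MT).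
have cM := cond_expP sF0 (iM _ sT).
rewrite -(integral_is_cond_exp sF0 cM); apply: ae_le_integral.
- exact: iM.
- by case: cM.
- by apply: leM => //; exact: aeW.
Qed.

Lemma supermartingale_system_ge : supermartingale_system P T F M ->
  (\int[P]_w (VT w)%:E <= \int[P]_w (V0 w)%:E)%E.
Proof.
move=> [_ iM leM].
rewrite -(integral_at mV0 (iM _ s0) M0) -(integral_at mVT (iM _ sT) MT).
have cM := cond_expP sF0 (iM _ sT).
rewrite -(integral_is_cond_exp sF0 cM); apply: ae_le_integral.
- by case: cM.
- exact: iM.
- by apply: leM => //; exact: aeW.
Qed.

End optimal_bounds.

Section boundary_values.
Context {d : measure_display} {Omega : measurableType d} {R : realType}.
Variables (P : probability Omega R) (T : R) (F : R -> set (set Omega)).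
Variables (f g h U : R -> Omega -> R).
Hypotheses (T_ge0 : 0 <= T) (F_filtration : filtration P T F).
Variables x y : Omega -> cumulative R R.
Hypotheses (px : forall w, unit_path T (x w)) (py : forall w, unit_path T (y w)).

Let T0 : (0 : R) <= 0 <= T. Proof. by apply/andP; split. Qed.
Let TT : 0 <= T <= T. Proof. by rewrite T_ge0 lexx. Qed.

Lemma accrued0 : accrued f g h x y (fun=> 0) = fun=> 0.
Proof.
apply/funext => w; rewrite /accrued set_itvco0 !Rintegral_set0 /signed_sum.
by rewrite !esum_set0 /= subrr !addr0.
Qed.

Let at0 : {ae P, forall w,
  cond_exp P (stopped T F (fun=> 0)) (accrued f g h x y (fun=> 0)) w = 0}.
Proof.
rewrite accrued0 (stopped_cst F_filtration T0).
by apply: cond_exp_cst; exact: (filtration_sub F_filtration T0).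
Qed.

Let left0 (z : Omega -> cumulative R R) : (forall w, unit_path T (z w)) ->
  {ae P, forall w, cond_exp P (stopped T F (fun=> 0))
    (fun w' => 1 - left_lim (z w') 0) w = 1}.
Proof.
move=> pz; rewrite (stopped_cst F_filtration T0).
rewrite (_ : (fun _ => _) = (fun=> 1)).
  by apply: cond_exp_cst; exact: (filtration_sub F_filtration T0).
by apply/funext => w; rewrite (left_lim0 (pz w)) subr0.
Qed.

Lemma Mhat_start : {ae P, forall w,
  Mhat P T f g h F U y x (fun=> 0) w = U 0 w}.
Proof.
have FF := ae_filter_ringOfSetsType P.
apply: filterS2 at0 (left0 py) => w a1 l1.
by rewrite /Mhat a1 l1 (left_lim0 (px w)) subr0 add0r !mul1r.
Qed.

Lemma Nhat_start : {ae P, forall w,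
  Nhat P T f g h F U x y (fun=> 0) w = U 0 w}.
Proof.
have FF := ae_filter_ringOfSetsType P.
apply: filterS2 at0 (left0 px) => w a1 l1.
by rewrite /Nhat a1 l1 (left_lim0 (py w)) subr0 add0r !mul1r.
Qed.

Let jump_left (z : Omega -> cumulative R R) : (forall w, unit_path T (z w)) ->
  (fun w => 1 - left_lim (z w) T) = (fun w => jump (z w) T).
Proof. by move=> pz; apply/funext => w; rewrite jumpT. Qed.

(** Paths equal 1 at T, so one minus the left limit is the jump there; the residual term then has
    exactly the form treated by the terminal condition. *)
Lemma Mhat_end : {ae P, forall w,
    cond_exp P (F T) (fun w' => jump (y w') T) w * U T w =
    cond_exp P (F T) (fun w' => jump (y w') T * h T w') w} ->
  {ae P, forall w, Mhat P T f g h F U y x (fun=> T) w =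
    cond_exp P (F T) (accrued f g h x y (fun=> T)) w +
    jump (x w) T * cond_exp P (F T) (fun w' => jump (y w') T * h T w') w}.
Proof.
have FF := ae_filter_ringOfSetsType P.
apply: filterS => w wE.
rewrite /Mhat (stopped_cst F_filtration TT) (jump_left py) -mulrA wE.
by rewrite (jumpT (px w)).
Qed.

Lemma Nhat_end : {ae P, forall w,
    cond_exp P (F T) (fun w' => jump (x w') T) w * U T w =
    cond_exp P (F T) (fun w' => jump (x w') T * h T w') w} ->
  {ae P, forall w, Nhat P T f g h F U x y (fun=> T) w =
    cond_exp P (F T) (accrued f g h x y (fun=> T)) w +
    jump (y w) T * cond_exp P (F T) (fun w' => jump (x w') T * h T w') w}.
Proof.
have FF := ae_filter_ringOfSetsType P.
apply: filterS => w wE.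
rewrite /Nhat (stopped_cst F_filtration TT) (jump_left px) mulrAC wE.
by rewrite mulrC (jumpT (py w)).
Qed.

End boundary_values.

(** * Value and saddle point *)

Theorem theorem4p2
  (d : measure_display) (Omega : measurableType d) (R : realType)
  (P : probability Omega R) (T : R) (F F1 F2 : R -> set (set Omega))
  (f g h : R -> Omega -> R) (D1 D2 : set {RV P >-> R})
  (U1 U2 : R -> Omega -> R) (xihat zetahat : Omega -> cumulative R R)
  (T_gt0 : 0 < T)
  (P_complete : measure_is_complete P)
  (F_filtration : filtration P T F)
  (F_proper : F T `<` @measurable d Omega)
  (F1_filtration : filtration P T F1)
  (F2_filtration : filtration P T F2)
  (F12_sub : forall t, 0 <= t <= T -> <<s F1 t `|` F2 t >> `<=` F t)
  (f_cadlag : forall w, cadlag_path T (f ^~ w))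
  (g_cadlag : forall w, cadlag_path T (g ^~ w))
  (h_cadlag : forall w, cadlag_path T (h ^~ w))
  (f_adapted : adapted T F f)
  (g_adapted : adapted T F g)
  (h_adapted : adapted T F h)
  (fgh_integrable : integrable_sup P T f g h)
  (devices : randomisation_devices T F D1 D2)
  (U1_progressive : progressive T F1 U1)
  (U2_progressive : progressive T F2 U2)
  (xihat_gen : generating T F1 xihat)
  (zetahat_gen : generating T F2 zetahat)
  (M_submartingale : forall xi, generating T F1 xi ->
    submartingale_system P T F1 (Mhat P T f g h F1 U1 zetahat xi))
  (N_supermartingale : forall zeta, generating T F2 zeta ->
    supermartingale_system P T F2 (Nhat P T f g h F2 U2 xihat zeta))
  (U1_terminal : {ae P, forall w,
    cond_exp P (F1 T) (fun w' => jump (zetahat w') T) w * U1 T w =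
    cond_exp P (F1 T) (fun w' => jump (zetahat w') T * h T w') w})
  (U2_terminal : {ae P, forall w,
    cond_exp P (F2 T) (fun w' => jump (xihat w') T) w * U2 T w =
    cond_exp P (F2 T) (fun w' => jump (xihat w') T * h T w') w})
  (U_initial : 'E_P[U1 0%R]%E = 'E_P[U2 0%R]%E) :
  let S1 := randomised_times T F1 D1 in
  let S2 := randomised_times T F2 D2 in
  [/\ upper_value P f g h S1 S2 = lower_value P f g h S1 S2,
      lower_value P f g h S1 S2 = 'E_P[U1 0%R]%E,
      'E_P[U1 0%R]%E = 'E_P[U2 0%R]%E
    & forall Z1 Z2, D1 Z1 -> D2 Z2 ->
        saddle_point P f g h S1 S2
          (rand_time T xihat Z1) (rand_time T zetahat Z2)].
Proof.
have T_ge0 : 0 <= T by exact: ltW.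
have TT : 0 <= T <= T by rewrite T_ge0 lexx.
have sG := filtration_sub F_filtration TT.
have sG1 := filtration_sub F1_filtration TT.
have sG2 := filtration_sub F2_filtration TT.
have F1F : F1 T `<=` F T.
  by move=> A FA; apply: (F12_sub _ TT); apply: sub_sigma_algebra; left.
have F2F : F2 T `<=` F T.
  by move=> A FA; apply: (F12_sub _ TT); apply: sub_sigma_algebra; right.
have adaptedT u t : adapted T F u -> 0 <= t <= T -> measurable_wrt (F T) (u t).
  move=> au t0T; apply: measurable_wrt_sub (au t t0T).
  exact: (filtration_T F_filtration t0T).
have [[D1_ne D2_ne] uD1 uD2 indep] := devices.
have path1 xi : generating T F1 xi -> forall w, unit_path T (xi w).
  by move=> xi_gen w; exact: generating_unit_path xi_gen.
have path2 zeta : generating T F2 zeta -> forall w, unit_path T (zeta w).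
  by move=> zeta_gen w; exact: generating_unit_path zeta_gen.
have meas1 xi t : generating T F1 xi -> measurable_wrt (F T) (fun w => xi w t).
  by move=> xi_gen; exact: (generating_measurable_wrt F1_filtration t F1F xi_gen).
have meas2 zeta t : generating T F2 zeta -> measurable_wrt (F T) (fun w => zeta w t).
  by move=> zeta_gen; exact: (generating_measurable_wrt F2_filtration t F2F zeta_gen).
have mU1 := progressive0 T_ge0 F1_filtration U1_progressive.
have mU2 := progressive0 T_ge0 F2_filtration U2_progressive.
have payoffE xi zeta Z1 Z2 : generating T F1 xi -> generating T F2 zeta ->
    D1 Z1 -> D2 Z2 ->
    expected_payoff P f g h (rand_time T xi Z1) (rand_time T zeta Z2) =
    (\int[P]_w (accrued f g h xi zeta (fun=> T) w +
      jump (xi w) T * (jump (zeta w) T * h T w))%:E)%E /\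
    P.-integrable setT (EFin \o accrued f g h xi zeta (fun=> T)).
  move=> xi_gen zeta_gen D1Z1 D2Z2; split.
    apply: (expected_payoffE T_ge0 sG) => //;
      [by move=> t; exact: adaptedT..|exact: path1|exact: path2|
       by move=> t; exact: meas1|by move=> t; exact: meas2|
       exact: uD1|exact: uD2|exact: indep].
  apply: (integrable_accrued T_ge0 sG f_cadlag g_cadlag h_cadlag _ _ _ _ _ _ _ _
    (uD1 _ D1Z1) (uD2 _ D2Z2) (indep _ _ D1Z1 D2Z2)) => //;
      [by move=> t; exact: adaptedT..|exact: path1|exact: path2|
       by move=> t; exact: meas1|by move=> t; exact: meas2].
have ijump z : (forall w, unit_path T (z w)) ->
    (forall t, measurable_wrt (F T) (fun w => z w t)) ->
    P.-integrable setT (EFin \o (fun w => jump (z w) T * h T w)).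
  move=> pz mz; apply: (integrable_terminal_jump T_ge0 sG _ fgh_integrable pz mz).
  by move=> t; exact: adaptedT.
have mcond G X : is_sub_sigma_algebra G -> P.-integrable setT (EFin \o X) ->
    measurable_fun setT (cond_exp P G X).
  by move=> sH iX; have [mX _ _] := cond_expP sH iX; exact: measurable_wrtW mX.
have lower xi Z1 Z2 : generating T F1 xi -> D1 Z1 -> D2 Z2 ->
    ('E_P[U1 0%R] <=
     expected_payoff P f g h (rand_time T xi Z1) (rand_time T zetahat Z2))%E.
  move=> xi_gen D1Z1 D2Z2.
  have [-> iA] := payoffE _ _ _ _ xi_gen zetahat_gen D1Z1 D2Z2.
  have iX := ijump _ (path2 _ zetahat_gen) (fun t => meas2 _ t zetahat_gen).
  have mk : measurable_wrt (F1 T) (fun w => jump (xi w) T).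
    apply: measurable_wrt_jump => t.
    exact: (generating_measurable_wrt F1_filtration t (@subset_refl _ _) xi_gen).
  (* Read backwards, the tower identity turns the expected payoff into the integral of the terminal
     value of [Mhat]. *)
  rewrite unlock -(integral_cond_expD sG1 iA iX mk); last first.
    by move=> w; apply: jump01; exact: path1.
  apply: (submartingale_system_le T_ge0 F1_filtration mU1 _ _ _
    (M_submartingale _ xi_gen)).
  - apply: measurable_funD; first exact: mcond.
    by apply: measurable_funM; [exact: measurable_wrtW mk|exact: mcond].
  - by apply: Mhat_start => //; [exact: path1|exact: path2].
  - by apply: Mhat_end => //; [exact: path1|exact: path2].
have upper zeta Z1 Z2 : generating T F2 zeta -> D1 Z1 -> D2 Z2 ->
    (expected_payoff P f g h (rand_time T xihat Z1) (rand_time T zeta Z2) <=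
     'E_P[U1 0%R])%E.
  move=> zeta_gen D1Z1 D2Z2; rewrite U_initial.
  have [-> iA] := payoffE _ _ _ _ xihat_gen zeta_gen D1Z1 D2Z2.
  have iX := ijump _ (path1 _ xihat_gen) (fun t => meas1 _ t xihat_gen).
  have mk : measurable_wrt (F2 T) (fun w => jump (zeta w) T).
    apply: measurable_wrt_jump => t.
    exact: (generating_measurable_wrt F2_filtration t (@subset_refl _ _) zeta_gen).
  (* The jumps exchange places: now the jump of [zeta] is the player's own and has to stand
     outside. *)
  under eq_integral do rewrite mulrCA.
  rewrite unlock -(integral_cond_expD sG2 iA iX mk); last first.
    by move=> w; apply: jump01; exact: path2.
  apply: (supermartingale_system_ge T_ge0 F2_filtration mU2 _ _ _
    (N_supermartingale _ zeta_gen)).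
  - apply: measurable_funD; first exact: mcond.
    by apply: measurable_funM; [exact: measurable_wrtW mk|exact: mcond].
  - by apply: Nhat_start => //; [exact: path1|exact: path2].
  - by apply: Nhat_end => //; [exact: path1|exact: path2].
move=> S1 S2.
have S1hat Z1 : D1 Z1 -> S1 (rand_time T xihat Z1).
  by move=> D1Z1; exists xihat => //; exists Z1.
have S2hat Z2 : D2 Z2 -> S2 (rand_time T zetahat Z2).
  by move=> D2Z2; exists zetahat => //; exists Z2.
have lowerS tau Z2 : S1 tau -> D2 Z2 ->
    ('E_P[U1 0%R] <= expected_payoff P f g h tau (rand_time T zetahat Z2))%E.
  by move=> [xi xi_gen [Z1 D1Z1 ->]] D2Z2; exact: lower.
have upperS sigma Z1 : S2 sigma -> D1 Z1 ->
    (expected_payoff P f g h (rand_time T xihat Z1) sigma <= 'E_P[U1 0%R])%E.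
  by move=> [zeta zeta_gen [Z2 D2Z2 ->]] D1Z1; exact: upper.
(* One device on each side realises the optimal strategies, which bound the infimum and the supremum
   over strategies. *)
have [Z10 D1Z10] := D1_ne; have [Z20 D2Z20] := D2_ne.
have le_upper : (upper_value P f g h S1 S2 <= 'E_P[U1 0%R])%E.
  apply: (@le_trans _ _ (ereal_sup
    [set expected_payoff P f g h (rand_time T xihat Z10) sigma | sigma in S2])).
    by apply: ereal_inf_lbound; exists (rand_time T xihat Z10) => //; exact: S1hat.
  by apply: ge_ereal_sup => _ [sigma S2sigma <-]; exact: upperS.
have ge_lower : ('E_P[U1 0%R] <= lower_value P f g h S1 S2)%E.
  apply: (@le_trans _ _ (ereal_inf
    [set expected_payoff P f g h tau (rand_time T zetahat Z20) | tau in S1])).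
    by apply: le_ereal_inf_tmp => _ [tau S1tau <-]; exact: lowerS.
  by apply: ereal_sup_ubound; exists (rand_time T zetahat Z20) => //; exact: S2hat.
(* Weak duality closes the chain E[U1_0] <= lower <= upper <= E[U1_0]. *)
have lower_upper : (lower_value P f g h S1 S2 <= upper_value P f g h S1 S2)%E.
  apply: ge_ereal_sup => _ [sigma S2sigma <-].
  apply: le_ereal_inf_tmp => _ [tau S1tau <-].
  apply: (@le_trans _ _ (expected_payoff P f g h tau sigma)).
    by apply: ereal_inf_lbound; exists tau.
  by apply: ereal_sup_ubound; exists sigma.
have lowerE : lower_value P f g h S1 S2 = 'E_P[U1 0%R]%E.
  by apply/eqP; rewrite eq_le ge_lower (le_trans lower_upper le_upper).
split => //.
  by rewrite lowerE; apply/eqP; rewrite eq_le le_upper (le_trans ge_lower lower_upper).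
move=> Z1 Z2 D1Z1 D2Z2; split; [exact: S1hat|exact: S2hat|].
(* Both inequalities pass through the constant E[U1_0], which separates the payoffs against [xihat]
   from those against [zetahat]. *)
move=> tau sigma S1tau S2sigma; split.
  apply: le_trans (upperS _ _ S2sigma D1Z1) _.
  by apply: lowerS => //; exact: S1hat.
apply: le_trans (lowerS _ _ S1tau D2Z2).
by apply: upperS => //; exact: S2hat.
Qed.
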